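(* Let $d\ge2$, and let $(X_1,\dots,X_n)$ be independent random variables distributed as $X$, where $X$ has a density $f_X$ on $[0,1]^d$ with $b\le f_X(x)\le M$ for all $x\in[0,1]^d$, for constants $b,M>0$. Consider a tree of depth $N\ge1$ on $[0,1]^d$ with cutting directions $D_i(x)$ and split positions $U_i(x)$, such that for all $x\in[0,1]^d$: $(D_i(x))_{i=1,\dots,N}$ and $(U_i(x))_{i=1,\dots,N}$ are independent; $(D_i(x))_{i=1,\dots,N}$ are independent with common uniform distribution on $\{1,\dots,d\}$; and there exists $\rho\in(0,1/2]$ (not depending on $x$) such that $U_i(x)\in[\rho,1-\rho]$ for all $i\in\{1,\dots,N\}$. Let $\nu=\log(\rho)/\log(1-\rho)$. For all $x\in[0,1]^d$, and all $N\ge1$ and $n\ge1$ such that $$16\log\left(192\,d\,\nu^4(2n+1)^{2d}\right)\le n\left(\frac{b\rho}{M}\right)^N,$$ the following two properties hold simultaneously with probability at least $\nu^{-4}/(24d)$: (i) the tree is $\tilde\alpha$-regular with $\tilde\alpha=b\rho/(8M)$, i.e. $P_n^X(\mathcal V_i(y))\ge\tilde\alpha P_n^X(\mathcal V_{i-1}(y))$ for all $y\in[0,1]^d$ and $i\in\{1,\dots,N\}$; (ii) $$\frac{h_+(\mathcal V_N(x))}{h_-(\mathcal V_N(x))}\ge(1-\rho)^{-\sqrt{N/d}}.$$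
   Context: $nP_n^X(V)=\sum_{i=1}^n\mathbf 1_V(X_i)$. For a hyper-rectangle $V$, $h_j(V)$ is its side length along coordinate $j$, $h_+(V)=\max_jh_j(V)$, $h_-(V)=\min_jh_j(V)$. Tree structure: $\mathcal V_0(x)=[0,1]^d$ for all $x$, and each depth-$(i-1)$ cell is split into two axis-aligned hyper-rectangles by a cut orthogonal to one coordinate axis; $\mathcal V_i(x)$ is the child of $\mathcal V_{i-1}(x)$ that contains $x$. $D_i(x)\in\{1,\dots,d\}$ is the cutting direction used to split $\mathcal V_{i-1}(x)$, and $U_i(x)=h_{D_i(x)}(\mathcal V_i(x))/h_{D_i(x)}(\mathcal V_{i-1}(x))\in(0,1)$ is the relative split position (child-to-parent side-length ratio); the other side lengths are unchanged. *)

(* Defs.v *)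
From HB Require Import structures.
From mathcomp Require Import all_boot all_order all_algebra.
From mathcomp Require Import all_classical all_reals all_analysis.

Set Implicit Arguments.
Unset Strict Implicit.
Unset Printing Implicit Defensive.

Import Order.TTheory GRing.Theory Num.Theory.
Import numFieldNormedType.Exports.

Local Open Scope classical_set_scope.
Local Open Scope ring_scope.

Section lebesgue_tuple.
Context {R : realType}.

Definition tuple_cons (n : nat) (p : measurableTypeR R * n.-tuple (measurableTypeR R)) :
  n.+1.-tuple (measurableTypeR R) := [tuple of p.1 :: p.2].

Lemma measurable_tuple_cons n : measurable_fun setT (@tuple_cons n).
Proof. exact: measurable_cons. Qed.

Definition tuple_uncons (n : nat) (t : n.+1.-tuple (measurableTypeR R)) :
  measurableTypeR R * n.-tuple (measurableTypeR R) :=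
  (thead t, [tuple of behead t]).

Lemma measurable_tuple_uncons n : measurable_fun setT (@tuple_uncons n).
Proof.
apply: measurable_fun_pair; [exact: measurable_tnth|exact: measurable_behead].
Qed.

Lemma tuple_consK n : cancel (@tuple_cons n) (@tuple_uncons n).
Proof. by case=> a t; rewrite /tuple_uncons; congr (_, _); apply: val_inj. Qed.

Section step.
Context (n : nat) (mu : {sigma_finite_measure set (n.-tuple (measurableTypeR R)) -> \bar R}).

Definition lebesgue_step : set (n.+1.-tuple (measurableTypeR R)) -> \bar R :=
  pushforward (lebesgue_measure \x mu)%E (@tuple_cons n).

Let preimage_cons B : measurable B -> measurable (@tuple_cons n @^-1` B).
Proof.
by move=> mB; rewrite -[X in measurable X]setTI; exact: measurable_tuple_cons.
Qed.

Let step0 : lebesgue_step set0 = 0%E.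
Proof. by rewrite /lebesgue_step /pushforward preimage_set0 measure0. Qed.

Let step_ge0 A : (0 <= lebesgue_step A)%E.
Proof. by rewrite /lebesgue_step /pushforward; exact: measure_ge0. Qed.

Let step_additive : semi_sigma_additive lebesgue_step.
Proof.
move=> F mF tF mUF; rewrite /lebesgue_step /pushforward preimage_bigcup.
apply: measure_semi_sigma_additive => [i||]; first exact: preimage_cons.
- apply/trivIsetP => /= i j _ _ ij; rewrite -preimage_setI.
  by move/trivIsetP : tF => /(_ _ _ _ _ ij) ->//; rewrite preimage_set0.
- by rewrite -preimage_bigcup; exact: preimage_cons.
Qed.

HB.instance Definition _ := isMeasure.Build _ _ _
  lebesgue_step step0 step_ge0 step_additive.

Let step_sigma_finite : sigma_finite setT lebesgue_step.
Proof.
have /sigma_finiteP[F [TF ndF Foo]] := sigma_finiteT (@lebesgue_measure R).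
have /sigma_finiteP[G [TG ndG Goo]] := sigma_finiteT mu.
exists (fun i => @tuple_uncons n @^-1` (F i `*` G i)).
  rewrite -preimage_bigcup (_ : \bigcup_i _ = setT) ?preimage_setT//.
  rewrite -setXTT TF TG predeqE => -[x y]; split.
    by move=> [i _ [/= Fx Gy]]; split; exists i.
  move=> [/= [i _ Fx] [k _ Gy]]; exists (maxn i k) => //; split.
  - by move: x Fx; exact/subsetPset/ndF/leq_maxl.
  - by move: y Gy; exact/subsetPset/ndG/leq_maxr.
move=> i; have [mF Fi] := Foo i; have [mG Gi] := Goo i; split.
  rewrite -[X in measurable X]setTI; apply: measurable_tuple_uncons => //.
  exact: measurableX.
rewrite /lebesgue_step /pushforward -comp_preimage.
rewrite (_ : _ \o _ = id); last by apply/funext => p /=; rewrite tuple_consK.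
by rewrite preimage_id product_measure1E// lte_mul_pinfty// ge0_fin_numE.
Qed.

HB.instance Definition _ := Measure_isSigmaFinite.Build _ _ _
  lebesgue_step step_sigma_finite.

End step.

(* d-dimensional Lebesgue measure: Dirac mass for d = 0, then iterated
   products with the one-dimensional Lebesgue measure. *)
Fixpoint lebesgue_tuple (d : nat) :
    {sigma_finite_measure set (d.-tuple (measurableTypeR R)) -> \bar R} :=
  if d is d'.+1 then lebesgue_step (lebesgue_tuple d')
  else \d_([tuple] : 0.-tuple (measurableTypeR R)).

End lebesgue_tuple.

Section independence.
Context {disp : measure_display} {T : measurableType disp} {R : realType}.
Variable P : probability T R.

(* Independence of two, resp. of a finite family of, sigma-algebras. *)
Definition independent2 (F G : set (set T)) : Prop :=
  forall A B, F A -> G B -> P (A `&` B) = (P A * P B)%E.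

Definition mutually_independent (I : finType) (F : I -> set (set T)) : Prop :=
  forall (J : {set I}) (E : I -> set T), (forall i, i \in J -> F i (E i)) ->
    P (\bigcap_(i in [set` J]) E i) = (\prod_(i in J) fine (P (E i)))%:E.

(* Sigma-algebra generated by a map Y into a space with sigma-algebra S;
   finite spaces carry S = setT. *)
Definition generated_by (U : Type) (S : set (set U)) (Y : T -> U) : set (set T) :=
  preimage_set_system setT Y S.

End independence.

Section boxes.
Context {R : realType} {d : nat}.

Definition vec := d.-tuple (measurableTypeR R).

(* A hyper-rectangle is given by its d side intervals. *)
Definition rect := 'I_d -> interval R.

Definition in_rect (V : rect) : set vec :=
  [set x | forall j, tnth x j \in V j].

Definition bound_val (e : itv_bound R) : R := if e is BSide _ c then c else 0.

Definition side (V : rect) (j : 'I_d) : R := bound_val (V j).2 - bound_val (V j).1.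

Definition h_plus (V : rect) : R := \big[Num.max/0]_(j < d) side V j.

(* The seed h_plus V dominates every side, so for d > 0 this is the minimum. *)
Definition h_minus (V : rect) : R := \big[Num.min/h_plus V]_(j < d) side V j.

Definition unit_rect : rect := fun=> `[0, 1].

Definition unit_cube : set vec := in_rect unit_rect.

End boxes.
Arguments vec R d : clear implicits.
Arguments rect R d : clear implicits.
Arguments unit_cube R d : clear implicits.
Arguments unit_rect R d : clear implicits.

Section trees.
Context {R : realType} {d : nat}.

(* A cut is orthogonal to axis cut_dir; cut_pos in ]0, 1[ is its position
   relative to the parent's side; cut_bit tells which child contains the
   cutting hyperplane (true: the upper one). *)
Record cut := Cut { cut_dir : 'I_d ; cut_pos : R ; cut_bit : bool }.

(* A node is addressed by the path leading to it from the root (false: lower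
   child, true: upper child); a tree of depth N only uses paths of size < N. *)
Definition tree := seq bool -> cut.

Definition cut_bound (V : rect R d) (c : cut) : itv_bound R :=
  BSide (cut_bit c)
    (bound_val (V (cut_dir c)).1 + cut_pos c * side V (cut_dir c)).

Definition child (V : rect R d) (c : cut) (upper : bool) : rect R d := fun j =>
  if j == cut_dir c then
    if upper then Interval (cut_bound V c) (V j).2
    else Interval (V j).1 (cut_bound V c)
  else V j.

(* Is x in the upper child? (when x belongs to V) *)
Definition goes_up (V : rect R d) (c : cut) (x : vec R d) : bool :=
  tnth x (cut_dir c) \in Interval (cut_bound V c) (V (cut_dir c)).2.

Fixpoint descend (t : tree) (x : vec R d) (i : nat) : seq bool * rect R d :=
  if i is i'.+1 then
    let: (s, V) := descend t x i' in
    let up := goes_up V (t s) x in (rcons s up, child V (t s) up)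
  else ([::], unit_rect R d).

Definition cell (t : tree) (x : vec R d) (i : nat) : rect R d :=
  (descend t x i).2.

(* Direction of the cut splitting the depth-i cell of x, and ratio of the
   resulting side lengths: these are D_{i+1}(x) and U_{i+1}(x). *)
Definition direction (t : tree) (x : vec R d) (i : nat) : 'I_d :=
  cut_dir (t (descend t x i).1).

Definition position (t : tree) (x : vec R d) (i : nat) : R :=
  side (cell t x i.+1) (direction t x i) / side (cell t x i) (direction t x i).

(* alpha-regularity up to depth N with respect to a set function mu. *)
Definition tree_regular (mu : set (vec R d) -> R) (alpha : R) (N : nat)
    (t : tree) : Prop :=
  forall y, unit_cube R d y -> forall i, (i < N)%N ->
    alpha * mu (in_rect (cell t y i)) <= mu (in_rect (cell t y i.+1)).

End trees.
Arguments cut R d : clear implicits.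
Arguments tree R d : clear implicits.

Section random.
Context {disp : measure_display} {Omega : measurableType disp} {R : realType}.
Variables (P : probability Omega R) (d : nat).

(* A random tree of depth N; its law and its dependence on the data are
   arbitrary. *)
Definition is_random_tree (N : nat) (t : Omega -> tree R d) : Prop :=
  forall s : seq bool, (size s < N)%N ->
  [/\ forall j, measurable [set w | cut_dir (t w s) = j],
      measurable_fun setT (fun w => cut_pos (t w s)),
      measurable_fun setT (fun w => cut_bit (t w s)) &
      forall w, 0 < cut_pos (t w s) < 1].

Definition directions (N : nat) (t : Omega -> tree R d) (x : vec R d)
  (w : Omega) : N.-tuple 'I_d := [tuple direction (t w) x i | i < N].

Definition positions (N : nat) (t : Omega -> tree R d) (x : vec R d)
  (w : Omega) : N.-tuple (measurableTypeR R) := [tuple position (t w) x i | i < N].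

Definition has_density_on_cube (f : vec R d -> R) (Y : Omega -> vec R d) :
    Prop :=
  measurable_fun (unit_cube R d) f /\
  forall A : set (vec R d), measurable A ->
    P (Y @^-1` A) = (\int[lebesgue_tuple d]_(x in A `&` unit_cube R d) (f x)%:E)%E.

Definition empirical (n : nat) (X : 'I_n -> Omega -> vec R d) (w : Omega)
  (V : set (vec R d)) : R := n%:R^-1 * \sum_(i < n) \1_V (X i w).

End random.

(* Main.v *)
(* All cells are compared with the finitely many boxes whose vertices lie on the
   grid of mesh 1/(2n).  Such a box has data probability between b and M times
   its volume, so Chernoff bounds and a union over the (2n+1)^(2d) boxes control
   the number of data points in all of them, whatever the dependence between
   tree and data; the sample-size condition makes the rounding error d/n
   negligible against the volume of a cell, which is at least rho^N.  For the
   shape, the logarithm of the ratio of two side lengths of the cell of x is a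
   sum of the logarithms of the U_i with independent symmetric weights in
   {-1, 0, 1}; for each fixed value of (U_i) the Paley-Zygmund inequality bounds
   its squared size from below with probability at least nu^-4/(8d), and the
   deviations above fail with probability at most nu^-4/(96d). *)

Require Import Defs.
From mathcomp Require Import all_boot all_order all_algebra.
From mathcomp Require Import all_classical all_reals all_analysis.
From mathcomp Require Import measurable_realfun ring lra zify.
Import Order.TTheory GRing.Theory Num.Theory.
Import numFieldNormedType.Exports.
Local Open Scope classical_set_scope.
Local Open Scope ring_scope.

Set Implicit Arguments.
Unset Strict Implicit.
Unset Printing Implicit Defensive.

(** * Finite probability and Chernoff bounds *)

(** Conditioning on the positions is never formalised. Directions take finitely many values, so the
    shape event is cut into slices by direction word; on a slice only the positions vary,
    independence factorises the probability, and summing the slices averages, under the law of the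
    positions, a plain mean over all words. Two fixed axes are enough, as the ratio of any two sides
    bounds [h_plus / h_minus] from below. Nothing links shape to deviations: the failure probability
    is simply subtracted. The factor 8 in the regularity constant absorbs a factor 2 from Chernoff
    on each side and a rounding loss of a quarter of the volume: counts lie between [3/8 n b v] and
    [5/2 n M v] for a cell of volume [v], and [20/3 <= 8]. The factor 16 is the lower-tail
    denominator 12 divided by [3/4]. A further obstacle is measurability: the event quantifies over
    all points [y], and the address of the cell of [x] is random. Both are resolved through the
    finitely many addresses of size at most [N]. *)

Section finite_probability.
Context {disp : measure_display} {T : measurableType disp} {R : realType}.
Variable P : probability T R.

Lemma measurable_set_ler (f g : T -> R) :
  measurable_fun setT f -> measurable_fun setT g ->
  measurable [set w | f w <= g w].
Proof.
move=> mf mg; rewrite -[X in measurable X]setTI.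
exact: measurable_fun_le.
Qed.

Lemma measurable_set_ltr (f g : T -> R) :
  measurable_fun setT f -> measurable_fun setT g ->
  measurable [set w | f w < g w].
Proof.
move=> mf mg; have := measurableC (measurable_set_ler mg mf).
congr measurable; apply/seteqP; split => w /=; last by rewrite ltNge => /negP.
by move=> /negP; rewrite -ltNge.
Qed.

Lemma fine_prob_ge0 A : 0 <= fine (P A).
Proof. exact: fine_ge0. Qed.

(** Integrates a pointwise inequality between finite combinations of indicators. Negative
    coefficients are allowed, so lower as well as upper bounds come from it: union bounds,
    differences, exponential moments and the averaging over positions are all instances. *)
Lemma prob_indic_le (I : finType) (a : I -> R) (A : I -> set T) (c : R)
    (G : set T) :
  (forall i, measurable (A i)) -> measurable G ->
  (forall w, c * \1_G w <= \sum_i a i * \1_(A i) w) ->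
  c * fine (P G) <= \sum_i a i * fine (P (A i)).
Proof.
move=> mA mG le.
have int1 B : measurable B -> P.-integrable setT (fun w => (\1_B w)%:E).
  by move=> mB; exact: integrable_indic.
have intZ k B : measurable B -> P.-integrable setT (fun w => (k * \1_B w)%:E).
  move=> mB; under eq_fun do rewrite EFinM.
  exact/integrableZl/int1.
have E k B : measurable B ->
    (\int[P]_w (k * \1_B w)%:E = (k * fine (P B))%:E)%E.
  move=> mB; under eq_integral do rewrite EFinM.
  rewrite integralZl//; last exact: int1.
  by rewrite integral_indic// setIT EFinM fineK// fin_num_measure.
rewrite -lee_fin -E// -sumEFin.
under eq_bigr do rewrite -E//.
rewrite -integral_sum//; last by move=> i; exact: intZ.
apply: le_integral => //; [exact: intZ| |].
  by apply: integrable_sum => // i _; exact: intZ.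
by move=> w _; rewrite sumEFin lee_fin.
Qed.

Lemma prob_le_mono A B : measurable A -> measurable B -> A `<=` B ->
  fine (P A) <= fine (P B).
Proof.
by move=> mA mB AB; rewrite fine_le ?fin_num_measure// le_measure// inE.
Qed.

Lemma prob_bigcup_le (I : finType) (A : I -> set T) :
  (forall i, measurable (A i)) ->
  fine (P (\bigcup_i A i)) <= \sum_i fine (P (A i)).
Proof.
move=> mA; rewrite -[leLHS]mul1r.
under eq_bigr do rewrite -[fine _]mul1r.
apply: prob_indic_le => //.
  by apply: fin_bigcup_measurable.
move=> w; rewrite mul1r [leLHS]indicE.
have [|_] := boolP (w \in _); last first.
  by apply: sumr_ge0 => i _; rewrite mul1r.
rewrite inE => -[i _ Aiw].
rewrite (bigD1 i)//= mul1r indicE mem_set// lerDl.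
by apply: sumr_ge0 => j _; rewrite mul1r.
Qed.

Lemma prob_setI_ge A B : measurable A -> measurable B ->
  fine (P A) - fine (P (~` B)) <= fine (P (A `&` B)).
Proof.
move=> mA mB.
have := @prob_indic_le bool (fun b => if b then 1 else 1)
  (fun b => if b then ~` B else A `&` B) 1 A.
rewrite !big_bool /= !mul1r lerBlDl; apply => //.
  by case; [exact: measurableC|exact: measurableI].
move=> w; rewrite big_bool /= !mul1r !indicE in_setC in_setI.
by case: (w \in A); case: (w \in B); rewrite /= ?addr0 ?add0r.
Qed.

(* Expanding the product over subsets avoids any theory of independent random
   variables: only probabilities of intersections are needed. *)
Lemma bernoulli_product_bound (n : nat) (A : 'I_n -> set T) (p c r : R)
    (G : set T) :
  (forall i, measurable (A i)) -> measurable G ->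
  (forall J : {set 'I_n}, P (\bigcap_(i in [set` J]) A i) = (p ^+ #|J|)%:E) ->
  -1 <= c ->
  (forall w, G w -> r <= \prod_i (1 + c * \1_(A i) w)) ->
  r * fine (P G) <= (1 + c * p) ^+ n.
Proof.
move=> mA mG indep c1 le.
have prodE w : \prod_i (1 + c * \1_(A i) w) =
    \sum_(J : {set 'I_n}) c ^+ #|J| * \1_(\bigcap_(i in [set` J]) A i) w.
  under eq_bigr do rewrite addrC.
  rewrite bigA_distr /=; apply: eq_big => [J|J _]; first by rewrite inE.
  rewrite -big_mkcond /= big_split /= prodr_const; congr (_ * _).
  rewrite indicE; case: (boolP (w \in _)) => [|wJ].
    rewrite inE => wJ; apply: big1 => i iJ.
    by rewrite indicE mem_set//; exact: wJ.
  have /exists_inP[i iJ wi] : [exists i in J, w \notin A i].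
    apply: contraNT wJ => /exists_inPn wJ'.
    by rewrite inE => i /= iJ; have := wJ' i iJ; rewrite negbK inE.
  by rewrite (bigD1 i)//= indicE (negbTE wi) mul0r.
have prod_ge0 w : 0 <= \prod_i (1 + c * \1_(A i) w).
  apply: prodr_ge0 => i _; rewrite indicE.
  by case: (w \in A i); rewrite ?mulr1 ?mulr0 ?addr0// -lerBlDl sub0r.
apply: (@le_trans _ _ (\sum_(J : {set 'I_n})
    c ^+ #|J| * fine (P (\bigcap_(i in [set` J]) A i)))).
  apply: prob_indic_le => // [J|w].
    by apply: fin_bigcap_measurable.
  rewrite -prodE indicE; case: (boolP (w \in G)) => [|_].
    by rewrite inE mulr1 => /le.
  by rewrite mulr0.
under eq_bigr do rewrite indep /= -exprMn.
suff -> : (1 + c * p) ^+ n = \sum_(J : {set 'I_n}) (c * p) ^+ #|J| by [].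
rewrite addrC -[X in _ ^+ X]card_ord -prodr_const bigA_distr /=.
apply: eq_big => [J|J _]; first by rewrite inE.
by rewrite -big_mkcond /= prodr_const.
Qed.

Lemma prod_indic_expR (n : nat) (A : 'I_n -> set T) (s : R) w :
  \prod_i (1 + (expR s - 1) * \1_(A i) w) = expR (s * \sum_i \1_(A i) w).
Proof.
rewrite mulr_sumr expR_sum; apply: eq_bigr => i _; rewrite indicE.
by case: (w \in A i); rewrite ?mulr1 ?mulr0 ?expR0 ?addr0// addrC subrK.
Qed.

(** Markov's inequality for [expR (s * count)]. Since [k] enters multiplied by [s], a negative [s]
    gives the lower tail and a positive one the upper tail; [1 + x <= expR x] then replaces the
    exact moment generating function. *)
Lemma chernoff (n : nat) (A : 'I_n -> set T) (p s k : R) (G : set T) :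
  (forall i, measurable (A i)) -> measurable G ->
  (forall J : {set 'I_n}, P (\bigcap_(i in [set` J]) A i) = (p ^+ #|J|)%:E) ->
  0 <= p <= 1 ->
  (forall w, G w -> s * k <= s * \sum_i \1_(A i) w) ->
  fine (P G) <= expR (n%:R * (p * (expR s - 1)) - s * k).
Proof.
move=> mA mG indep /andP[p0 p1] le.
have c1 : -1 <= expR s - 1 by rewrite lerBrDl subrr expR_ge0.
rewrite expRD expRN ler_pdivlMr ?expR_gt0// mulrC.
apply: le_trans (bernoulli_product_bound (r := expR (s * k)) mA mG indep c1 _) _.
  by move=> w Gw; rewrite prod_indic_expR ler_expR le.
rewrite expRM_natl lerXn2r ?nnegrE ?expR_ge0//.
  by have := ler_wpM2r p0 c1; lra.
by rewrite [p * _]mulrC; exact: expR_ge1Dx.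
Qed.

Lemma measurable_count (n : nat) (A : 'I_n -> set T) :
  (forall i, measurable (A i)) ->
  measurable_fun setT (fun w => \sum_i \1_(A i) w : R).
Proof. by move=> mA; apply: measurable_sum => i; exact: measurable_indic. Qed.

Lemma measurable_count_lt (n : nat) (A : 'I_n -> set T) (k : R) :
  (forall i, measurable (A i)) ->
  measurable [set w | \sum_i \1_(A i) w < k].
Proof.
move=> /measurable_count m.
by apply: measurable_set_ltr => //; exact: measurable_cst.
Qed.

Lemma measurable_count_gt (n : nat) (A : 'I_n -> set T) (k : R) :
  (forall i, measurable (A i)) ->
  measurable [set w | k < \sum_i \1_(A i) w].
Proof.
move=> /measurable_count m.
by apply: measurable_set_ltr => //; exact: measurable_cst.
Qed.

(** [q] is a known lower bound on the unknown probability [p]: for a box, [b] times its volume. *)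
Lemma chernoff_lower (n : nat) (A : 'I_n -> set T) (p q : R) :
  (forall i, measurable (A i)) ->
  (forall J : {set 'I_n}, P (\bigcap_(i in [set` J]) A i) = (p ^+ #|J|)%:E) ->
  0 <= q <= p -> p <= 1 ->
  fine (P [set w | \sum_i \1_(A i) w < n%:R * q / 2]) <=
  expR (- (n%:R * q / 12)).
Proof.
move=> mA indep /andP[q0 qp] p1.
(* With [s = -1/2] and [expR (-1/2) - 1 <= -1/3], the exponent is at most [n q (-1/3 + 1/4)]. *)
apply: le_trans (chernoff (s := - 2^-1) (k := n%:R * q / 2) mA _ indep _ _) _.
- exact: measurable_count_lt.
- by rewrite p1 (le_trans q0 qp).
- by move=> w /= /ltW; rewrite !mulNr lerN2 => ?; rewrite ler_wpM2l.
rewrite ler_expR.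
have e1 : expR (- 2^-1) - 1 <= - (3^-1 : R).
  rewrite expRN lerBlDr.
  have h := expR_ge1Dx (2^-1 : R).
  apply: le_trans (_ : (1 + 2^-1)^-1 <= _).
    by rewrite lef_pV2// posrE; lra.
  suff -> : (1 + 2^-1)^-1 = 2 / 3 :> R by lra.
  by field.
have : n%:R * (p * (expR (- 2^-1) - 1)) <= n%:R * (q * - 3^-1) :> R.
  apply: ler_wpM2l => //; apply: le_trans (_ : p * - 3^-1 <= _).
    by apply: ler_wpM2l => //; lra.
  by rewrite !mulrN lerN2 ler_wpM2r.
lra.
Qed.

Lemma chernoff_upper (n : nat) (A : 'I_n -> set T) (p q : R) :
  (forall i, measurable (A i)) ->
  (forall J : {set 'I_n}, P (\bigcap_(i in [set` J]) A i) = (p ^+ #|J|)%:E) ->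
  0 <= p <= q -> p <= 1 ->
  fine (P [set w | 2 * (n%:R * q) < \sum_i \1_(A i) w]) <=
  expR (- (n%:R * q / 6)).
Proof.
Proof.
move=> mA indep /andP[p0 pq] p1.
(* With [s = 1/4] and [expR (1/4) - 1 <= 1/3], the exponent is at most [n q (1/3 - 1/2)]. *)
apply: le_trans (chernoff (s := 4^-1) (k := 2 * (n%:R * q)) mA _ indep _ _) _.
- exact: measurable_count_gt.
- by rewrite p0.
- by move=> w /= /ltW ?; rewrite ler_wpM2l.
rewrite ler_expR.
have e1 : expR 4^-1 - 1 <= (3^-1 : R).
  have -> : expR (4^-1 : R) = (expR (- 4^-1))^-1 by rewrite expRN invrK.
  rewrite lerBlDr.
  have h := expR_ge1Dx (- 4^-1 : R).
  apply: le_trans (_ : (1 - 4^-1)^-1 <= _).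
    by rewrite lef_pV2// posrE; lra.
  suff -> : (1 - 4^-1)^-1 = 4 / 3 :> R by lra.
  by field.
have : n%:R * (p * (expR 4^-1 - 1)) <= n%:R * (q * 3^-1) :> R.
  apply: ler_wpM2l => //; apply: le_trans (_ : p * 3^-1 <= _).
    by apply: ler_wpM2l => //; lra.
  by rewrite ler_wpM2r.
lra.
Qed.
End finite_probability.

(** * Anticoncentration of random signed sums *)

Section paley_zygmund.
Context {R : realType} {d : nat}.
Variables a0 a1 : 'I_d.
Hypothesis a01 : a0 != a1.

(** When [L i] is minus the logarithm of the [i]-th split, the signed sum is the log side along [a1]
    minus the log side along [a0], since a cut along an axis shortens that side. *)
Definition direction_sign (k : 'I_d) : R := (k == a0)%:R - (k == a1)%:R.

Definition signed_sum (N : nat) (L : nat -> R) (t : N.-tuple 'I_d) : R :=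
  \sum_(i < N) L i * direction_sign (tnth t i).

(** Expectation over [N] independent uniform directions, as an average over words; the positions are
    frozen in [L]. *)
Definition tuple_mean (N : nat) (F : N.-tuple 'I_d -> R) : R :=
  d%:R ^- N * \sum_t F t.

Let d_gt0 : 0 < d%:R :> R.
Proof. by rewrite ltr0n (leq_ltn_trans _ (ltn_ord a0)). Qed.

(** The values are -1, 0 and 1, so any polynomial in a sign reduces to degree two, where
    [sum_direction_sign] applies. *)
Lemma direction_sign3 k : direction_sign k ^+ 3 = direction_sign k.
Proof.
rewrite /direction_sign; case: eqP; case: eqP => _ _ /=.
all: by rewrite ?subrr ?subr0 ?sub0r ?expr1n ?expr0n// -signr_odd /= expr1.
Qed.

Lemma sum_direction_sign (A B C : R) :
  \sum_k (A + B * direction_sign k + C * direction_sign k ^+ 2) =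
  d%:R * A + 2 * C.
Proof.
have delta (b : 'I_d) : \sum_k (k == b)%:R = 1 :> R.
  by rewrite (bigD1 b)//= eqxx big1 ?addr0// => k /negbTE ->.
have sq k : direction_sign k ^+ 2 = (k == a0)%:R + (k == a1)%:R.
  rewrite /direction_sign; have [->|_] := eqVneq k a0.
    by rewrite (negbTE a01) /= subr0 addr0 expr1n.
  by rewrite sub0r sqrrN add0r; case: eqP => _ /=; rewrite ?expr1n ?expr0n.
rewrite !big_split /= -!mulr_sumr sumr_const card_ord mulr_natl.
under [in X in _ + C * X]eq_bigr do rewrite sq.
rewrite /direction_sign sumrB !delta big_split /= !delta subrr mulr0 addr0.
by rewrite mulrC.
Qed.

(** Conditioning on the first direction; it drives the induction on [N] for both moments. *)
Lemma tuple_mean_cons (N : nat) (F : N.+1.-tuple 'I_d -> R) :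
  tuple_mean F = tuple_mean (fun t => d%:R^-1 * \sum_k F (cons_tuple k t)).
Proof.
rewrite /tuple_mean -mulr_sumr mulrA exprSr invfM [_^-1 * _^-1]mulrC.
congr (_ * _).
rewrite exchange_big pair_big /=.
pose h (p : 'I_d * N.-tuple 'I_d) := cons_tuple p.1 p.2.
rewrite (reindex h) //=.
exists (fun t => (thead t, behead_tuple t)) => [[k t]|t] _.
  by rewrite /h /=; congr pair; apply: val_inj.
by rewrite /h /= [RHS]tuple_eta; apply: val_inj.
Qed.

Lemma signed_sum_cons (N : nat) (L : nat -> R) k (t : N.-tuple 'I_d) :
  signed_sum L (cons_tuple k t) =
  L 0%N * direction_sign k + signed_sum (fun i => L i.+1) t.
Proof.
rewrite /signed_sum big_ord_recl /= tnth0; congr (_ + _).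
by apply: eq_bigr => i _; rewrite tnthS.
Qed.

Lemma eq_tuple_mean (N : nat) (F G : N.-tuple 'I_d -> R) :
  F =1 G -> tuple_mean F = tuple_mean G.
Proof. by move=> FG; rewrite /tuple_mean (eq_bigr _ (fun t _ => FG t)). Qed.

Lemma tuple_meanD (N : nat) (F G : N.-tuple 'I_d -> R) :
  tuple_mean (fun t => F t + G t) = tuple_mean F + tuple_mean G.
Proof. by rewrite /tuple_mean big_split mulrDr. Qed.

Lemma tuple_meanZ (N : nat) (c : R) (F : N.-tuple 'I_d -> R) :
  tuple_mean (fun t => c * F t) = c * tuple_mean F.
Proof. by rewrite /tuple_mean -mulr_sumr mulrCA. Qed.

Lemma tuple_mean_cst (N : nat) (c : R) : tuple_mean (fun _ : N.-tuple 'I_d => c) = c.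
Proof.
rewrite /tuple_mean sumr_const card_tuple card_ord -[X in _ * X]mulr_natl natrX mulKf//.
by rewrite expf_neq0// gt_eqF.
Qed.

Lemma le_tuple_mean (N : nat) (F G : N.-tuple 'I_d -> R) :
  (forall t, F t <= G t) -> tuple_mean F <= tuple_mean G.
Proof.
move=> FG; rewrite /tuple_mean ler_wpM2l ?invr_ge0 ?exprn_ge0//.
by apply: ler_sum.
Qed.

Lemma signed_sum_moment2 (N : nat) (L : nat -> R) :
  tuple_mean (fun t : N.-tuple 'I_d => signed_sum L t ^+ 2) =
  2 / d%:R * \sum_(i < N) L i ^+ 2.
Proof.
elim: N L => [|N IH] L.
  rewrite big_ord0 mulr0 -[RHS](tuple_mean_cst 0); apply: eq_tuple_mean => t.
  by rewrite /signed_sum big_ord0 expr0n.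
rewrite tuple_mean_cons big_ord_recl /= mulrDr -(IH (fun i => L i.+1)).
rewrite -[X in X + _](tuple_mean_cst N) -tuple_meanD; apply: eq_tuple_mean => t.
under eq_bigr do rewrite signed_sum_cons.
set z := signed_sum _ t; set x := L 0%N.
rewrite (eq_bigr (fun k => z ^+ 2 + 2 * z * x * direction_sign k +
  x ^+ 2 * direction_sign k ^+ 2)); last by move=> k _; ring.
by rewrite sum_direction_sign; field; rewrite gt_eqF.
Qed.

(** Odd powers of the first sign average to 0, so peeling it off adds [6 (2/d) x^2] times the second
    moment and [(2/d) x^4]. The former is exactly the cross term of the square on the right. *)
Lemma signed_sum_moment4 (N : nat) (L : nat -> R) :
  tuple_mean (fun t : N.-tuple 'I_d => signed_sum L t ^+ 4) <=
  3 * (2 / d%:R * \sum_(i < N) L i ^+ 2) ^+ 2 + 2 / d%:R * \sum_(i < N) L i ^+ 4.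
Proof.
elim: N L => [|N IH] L.
  rewrite !big_ord0 !mulr0 expr0n mulr0 addr0 -[leRHS](tuple_mean_cst 0).
  by apply: le_tuple_mean => t; rewrite /signed_sum big_ord0 expr0n.
rewrite tuple_mean_cons !big_ord_recl /=.
set x := L 0%N.
have -> : tuple_mean (fun t : N.-tuple 'I_d =>
    d%:R^-1 * \sum_k signed_sum L (cons_tuple k t) ^+ 4) =
  tuple_mean (fun t : N.-tuple 'I_d => signed_sum (fun i => L i.+1) t ^+ 4) +
  (12 / d%:R * x ^+ 2 * tuple_mean (fun t : N.-tuple 'I_d =>
     signed_sum (fun i => L i.+1) t ^+ 2) + 2 / d%:R * x ^+ 4).
  rewrite -tuple_meanZ -[X in _ = _ + (_ + X)](tuple_mean_cst N) -!tuple_meanD.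
  apply: eq_tuple_mean => t.
  under eq_bigr do rewrite signed_sum_cons.
  set z := signed_sum _ t; rewrite -/x.
  rewrite (eq_bigr (fun k => z ^+ 4 +
    (4 * z ^+ 3 * x + 4 * z * x ^+ 3) * direction_sign k +
    (6 * z ^+ 2 * x ^+ 2 + x ^+ 4) * direction_sign k ^+ 2)).
    by rewrite sum_direction_sign; field; rewrite gt_eqF.
  move=> k _; have := direction_sign3 k; set e := direction_sign k => e3.
  have e4 : e ^+ 4 = e ^+ 2 by rewrite exprS e3 expr2.
  rewrite (_ : (x * e + z) ^+ 4 = z ^+ 4 + 4 * z ^+ 3 * x * e +
    6 * z ^+ 2 * x ^+ 2 * e ^+ 2 + 4 * z * x ^+ 3 * e ^+ 3 + x ^+ 4 * e ^+ 4);
    last by ring.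
  by rewrite e3 e4; ring.
rewrite signed_sum_moment2.
have := IH (fun i => L i.+1).
set S2 := \sum_(i < N) _; set S4 := \sum_(i < N) _ ^+ 4; set m := tuple_mean _.
set q := d%:R^-1 => le.
(* The slack is [3 (2 x^2 / d)^2], the diagonal term of the square. *)
have : 0 <= (q * x ^+ 2) ^+ 2 by exact: sqr_ge0.
nra.
Qed.

(* [1_(y >= v/2) >= 2 s (y - v/2) - s^2 y^2] for every [s >= 0]; integrating
   with [s = v / (2 E)] replaces Cauchy-Schwarz in Paley-Zygmund. *)
Lemma signed_sum_anticoncentration (N : nat) (L : nat -> R) (l nu : R) :
  (0 < N)%N -> 0 < l -> 1 <= nu ->
  (forall i, (i < N)%N -> l <= L i <= nu * l) ->
  (1 < d)%N ->
  nu ^- 4 / (8 * d%:R) <= tuple_mean (fun t : N.-tuple 'I_d =>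
    (N%:R / d%:R * l ^+ 2 <= signed_sum L t ^+ 2)%R%:R).
Proof.
move=> N0 l0 nu1 hL d2.
have d2R : 2 <= d%:R :> R by rewrite ler_nat.
have sum_ord_cst (c : R) : \sum_(i < N) c = N%:R * c.
  by rewrite sumr_const card_ord mulr_natl.
have N1R : 1 <= N%:R :> R by rewrite ler1n.
have [v vE] : exists v, v = 2 / d%:R * \sum_(i < N) L i ^+ 2 by eexists.
have [q qE] : exists q : R, q = 2 / d%:R by exists (2 / d%:R).
have q0 : 0 < q by rewrite qE divr_gt0.
have hv : q * N%:R * l ^+ 2 <= v.
  rewrite vE -qE -mulrA ler_wpM2l ?(ltW q0)//.
  rewrite -sum_ord_cst; apply: ler_sum => i _.
  have /andP[h _] := hL i (ltn_ord i).
  by rewrite lerXn2r// nnegrE ltW// (lt_le_trans l0).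
have v0 : 0 < v.
  by apply: lt_le_trans hv; rewrite !mulr_gt0 ?exprn_gt0 ?ltr0n.
set E := 3 * v ^+ 2 + q * (N%:R * (nu * l) ^+ 4).
have hE : tuple_mean (fun t : N.-tuple 'I_d => signed_sum L t ^+ 4) <= E.
  apply: le_trans (signed_sum_moment4 N L) _.
  rewrite -vE -qE lerD2l ler_wpM2l ?(ltW q0)//.
  rewrite -sum_ord_cst; apply: ler_sum => i _.
  have /andP[h1 h2] := hL i (ltn_ord i).
  have Li0 : 0 <= L i by rewrite ltW// (lt_le_trans l0).
  by rewrite lerXn2r// nnegrE// (le_trans Li0).
have E0 : 0 < E.
  apply: ltr_wpDr; last by rewrite mulr_gt0 ?exprn_gt0.
  by apply: mulr_ge0; rewrite ?(ltW q0)// mulr_ge0// exprn_even_ge0.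
(* As [d >= 2], [3 v^2] is at most [3/2 d v^2]; [v >= q N l^2] and [N >= 1] bound the fourth-power
   term by [1/2 d v^2 nu^4]. *)
have E8 : E <= v ^+ 2 * (2 * d%:R * nu ^+ 4).
  have nu4 : 1 <= nu ^+ 4 by rewrite exprn_ege1.
  have hv2 : q * (N%:R * l ^+ 4) * (q * N%:R) <= v ^+ 2.
    apply: le_trans (_ : (q * N%:R * l ^+ 2) ^+ 2 <= _).
      by rewrite le_eqVlt; apply/orP; left; apply/eqP; ring.
    by rewrite lerXn2r ?nnegrE ?(ltW v0)// mulr_ge0 ?sqr_ge0// mulr_ge0// ltW.
  have hv3 : q * (N%:R * l ^+ 4) * 2 <= v ^+ 2 * d%:R.
    have A0 : 0 <= q * (N%:R * l ^+ 4).
      by rewrite mulr_ge0 ?(ltW q0)// mulr_ge0// exprn_even_ge0.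
    apply: le_trans (ler_wpM2r (ltW d_gt0) hv2).
    rewrite -[leRHS]mulrA ler_wpM2l//.
    suff -> : q * N%:R * d%:R = 2 * N%:R by lra.
    by rewrite qE; field; rewrite gt_eqF.
  rewrite /E [(nu * l) ^+ 4]exprMn.
  have : q * (N%:R * l ^+ 4) * 2 * nu ^+ 4 <= v ^+ 2 * d%:R * nu ^+ 4.
    by rewrite ler_wpM2r// (le_trans ler01).
  have : v ^+ 2 * 2 <= v ^+ 2 * d%:R by rewrite ler_wpM2l// sqr_ge0.
  have : v ^+ 2 * d%:R * 1 <= v ^+ 2 * d%:R * nu ^+ 4.
    by rewrite ler_wpM2l// mulr_ge0 ?sqr_ge0.
  have : 0 <= v ^+ 2 by exact: sqr_ge0.
  lra.
(* [s] maximises [s v - s^2 E]; the maximum [v^2 / (4 E)] is at least [nu^-4 / (8 d)] by [E8]. *)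
set s := v / (2 * E).
have s0 : 0 <= s by rewrite divr_ge0 ?(ltW v0)// mulr_ge0// ltW.
apply: le_trans (_ : s * v - s ^+ 2 * E <= _).
  have -> : s * v - s ^+ 2 * E = v ^+ 2 / (4 * E) by rewrite /s; field; rewrite gt_eqF.
  have nu0 : 0 < nu by rewrite (lt_le_trans ltr01).
  rewrite ler_pdivlMr ?mulr_gt0// mulrAC ler_pdivrMr ?mulr_gt0//.
  rewrite mulrC ler_pdivrMr ?exprn_gt0//.
  nra.
apply: (@le_trans _ _ (tuple_mean (fun t : N.-tuple 'I_d =>
   - (s * v) + ((2 * s) * signed_sum L t ^+ 2 + (- s ^+ 2) * signed_sum L t ^+ 4)))).
  rewrite !tuple_meanD !tuple_meanZ tuple_mean_cst signed_sum_moment2 -vE.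
  have := ler_wpM2l (sqr_ge0 s) hE; lra.
apply: le_tuple_mean => t; set y := signed_sum L t.
have -> : y ^+ 4 = (y ^+ 2) ^+ 2 by rewrite -exprM.
set y2 := y ^+ 2.
case: (leP (N%:R / d%:R * l ^+ 2)) => h /=.
  have : 0 <= (1 - s * y2) ^+ 2 by exact: sqr_ge0.
  have : 0 <= s * v by rewrite mulr_ge0// ltW.
  nra.
(* The threshold [N / d * l^2] is half of the lower bound [q N l^2] on the second moment [v]. *)
have : y2 <= v / 2.
  apply: le_trans (ltW h) _; rewrite ler_pdivlMr//; apply: le_trans hv.
  by rewrite le_eqVlt qE; apply/orP; left; apply/eqP; ring.
have := sqr_ge0 (s * y2).
nra.
Qed.
End paley_zygmund.

(** * Boxes *)

Section boxes.
Context {R : realType}.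

Definition box (d : nat) (a c : 'I_d -> R) : rect R d := fun j => `[a j, c j].

Lemma measurable_in_rect (d : nat) (V : rect R d) : measurable (in_rect V).
Proof.
rewrite (_ : in_rect V = \bigcap_(j in [set: 'I_d])
    ((@tnth d (measurableTypeR R))^~ j @^-1` [set` V j])); last first.
  by apply/seteqP; split => x /= h j; [move=> _; exact: h|exact: (h j I)].
apply: fin_bigcap_measurable => [//|j _].
rewrite -[X in measurable X]setTI.
exact: (measurable_tnth j).
Qed.

Lemma lebesgue_tuple_box (d : nat) (a c : 'I_d -> R) :
  (forall j, a j <= c j) ->
  lebesgue_tuple d (in_rect (box a c)) = (\prod_j (c j - a j))%:E.
Proof.
elim: d a c => [|d IH] a c ac.
  rewrite big_ord0 /= diracE mem_set//.
  by case.
rewrite big_ord_recl EFinM /= /lebesgue_step /pushforward.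
rewrite (_ : _ @^-1` _ = `[a ord0, c ord0]%classic `*`
  in_rect (box (a \o lift ord0) (c \o lift ord0))); last first.
  apply/seteqP; split => -[x t] /=.
    move=> h; split => [|j]; first exact: (h ord0).
    by have := h (lift ord0 j); rewrite /tuple_cons /= tnthS.
  move=> [hx ht] j; case: (unliftP ord0 j) => [i ->|->].
    by rewrite /tuple_cons tnthS; exact: ht.
  exact: hx.
rewrite product_measure1E//; last exact: measurable_in_rect.
rewrite IH; last by move=> j; exact: ac.
rewrite -[X in (X * _)%E]/(lebesgue_measure _) lebesgue_measure_itv /= lte_fin; case: ltgtP (ac ord0) => //.
by move=> -> _; rewrite subrr.
Qed.

Context {disp : measure_display} {Omega : measurableType disp}.
Variables (P : probability Omega R) (d : nat) (f : vec R d -> R).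
Variable Y : Omega -> vec R d.
Hypothesis density : has_density_on_cube P f Y.

Lemma box_sub_cube (a c : 'I_d -> R) : (forall j, 0 <= a j) ->
  (forall j, c j <= 1) -> in_rect (box a c) `<=` unit_cube R d.
Proof.
move=> a0 c1 y h j; have := h j; rewrite !in_itv /= => /andP[h1 h2].
by rewrite (le_trans (a0 j) h1) (le_trans h2 (c1 j)).
Qed.

Lemma density_box_bounds (b M : R) (a c : 'I_d -> R) :
  0 <= b -> (forall y, unit_cube R d y -> b <= f y <= M) ->
  (forall j, 0 <= a j) -> (forall j, a j <= c j) -> (forall j, c j <= 1) ->
  b * \prod_j (c j - a j) <= fine (P (Y @^-1` in_rect (box a c))) <=
  M * \prod_j (c j - a j).
Proof.
move=> b0 fb a0 ac c1; have [mf ->] := density; last exact: measurable_in_rect.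
have sub := box_sub_cube a0 c1.
have mG : measurable (in_rect (box a c)) by exact: measurable_in_rect.
rewrite (setIidl sub).
have mfG : measurable_fun (in_rect (box a c)) (fun x => (f x)%:E).
  apply/measurable_EFinP; apply: measurable_funS mf => //.
  exact: measurable_in_rect.
have lo : ((b * \prod_j (c j - a j))%:E <=
    \int[lebesgue_tuple d]_(x in in_rect (box a c)) (f x)%:E)%E.
  rewrite EFinM -(lebesgue_tuple_box ac) -integral_cst//.
  apply: ge0_le_integral => // x Gx.
  by rewrite lee_fin; have /andP[] := fb x (sub x Gx).
have hi : (\int[lebesgue_tuple d]_(x in in_rect (box a c)) (f x)%:E <=
    (M * \prod_j (c j - a j))%:E)%E.
  rewrite EFinM -(lebesgue_tuple_box ac) -integral_cst//.
  apply: ge0_le_integral => // x Gx.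
  - have /andP[h1 h2] := fb x (sub x Gx).
    by rewrite lee_fin (le_trans b0)// (le_trans h1).
  - by rewrite lee_fin; have /andP[] := fb x (sub x Gx).
rewrite -!lee_fin fineK; first by rewrite lo hi.
rewrite fin_numElt (lt_le_trans _ lo) ?ltNyr//=.
by rewrite (le_lt_trans hi)// ltry.
Qed.

(** The cube has volume one and carries the whole mass of [Y]. *)
Lemma density_bound_ge1 (b M : R) : 0 <= b ->
  (forall y, unit_cube R d y -> b <= f y <= M) -> 1 <= M.
Proof.
move=> b0 fb.
have /andP[_] := @density_box_bounds b M (fun=> 0) (fun=> 1) b0 fb
  (fun=> lexx _) (fun=> ler01) (fun=> lexx _).
rewrite big1 => [|j _]; last by rewrite subr0.
rewrite mulr1; apply: le_trans.
have [mf ->] := density; last exact: measurable_in_rect.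
rewrite setIidl; last by apply: box_sub_cube => j.
have := density.2 setT measurableT.
by rewrite setTI preimage_setT probability_setT => <-.
Qed.
End boxes.

(** * Grid approximation of rectangles *)

Section rounding.
Context {R : realType}.

(** Telescoping: [y Y - x X = (y - x) Y + x (Y - X)] with all factors at most 1. It turns the
    rounding errors of the sides into an additive error on the volume. *)
Lemma prodrB_le (I : Type) (s : seq I) (x y : I -> R) :
  (forall i, 0 <= x i) -> (forall i, x i <= y i) -> (forall i, y i <= 1) ->
  \prod_(i <- s) y i - \prod_(i <- s) x i <= \sum_(i <- s) (y i - x i).
Proof.
move=> x0 xy y1.
have y0 i : 0 <= y i by exact: le_trans (xy i).
elim: s => [|i s IH]; first by rewrite !big_nil subrr.
rewrite !big_cons.
have Y1 : \prod_(j <- s) y j <= 1.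
  by apply: prodr_ile1 => j _; rewrite y0 y1.
have X0 : \prod_(j <- s) x j <= \prod_(j <- s) y j.
  by apply: ler_prod => j _; rewrite x0 xy.
move: IH Y1 X0; set Y := \prod_(j <- s) y j; set X := \prod_(j <- s) x j.
move=> IH Y1 X0.
have h1 : (y i - x i) * Y <= y i - x i by rewrite ler_piMr ?subr_ge0.
have h2 : x i * (Y - X) <= Y - X.
  by rewrite ler_piMl ?subr_ge0// (le_trans (xy i)).
lra.
Qed.

Lemma prodr_le_factor (d : nat) (x : 'I_d -> R) j :
  (forall i, 0 <= x i <= 1) -> \prod_i x i <= x j.
Proof.
move=> h; rewrite (bigD1 j)//= ler_piMr//; first by have /andP[] := h j.
by apply: prodr_ile1 => i _; exact: h.
Qed.

(** [r < 1] keeps [k + 1] within the grid, and the strict inequality places that grid point beyond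
    [r], as inner boxes need. *)
Lemma exists_grid_floor (K : nat) (r : R) : (0 < K)%N -> 0 <= r < 1 ->
  exists k, (k < K)%N /\ k%:R / K%:R <= r < k.+1%:R / K%:R.
Proof.
move=> K0 /andP[r0 r1]; have K0R : 0 < K%:R :> R by rewrite ltr0n.
have rK0 : 0 <= r * K%:R by rewrite mulr_ge0// ltW.
have /andP[h1 h2] := truncn_itv rK0.
exists (Num.truncn (r * K%:R)); split.
  by rewrite -(ltr_nat R) (le_lt_trans h1)// gtr_pMl.
by rewrite ler_pdivrMr// h1 ltr_pdivlMr.
Qed.
End rounding.

Section proper_rectangles.
Context {R : realType} {d : nat}.

Definition lo (V : rect R d) j := bound_val (V j).1.
Definition hi (V : rect R d) j := bound_val (V j).2.
Definition volume (V : rect R d) : R := \prod_j side V j.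

(** [bound_val] forgets whether an endpoint is included and sends infinite ends to 0. This predicate
    makes [lo] and [hi] genuine endpoints while leaving each face free to be in or out, as cuts
    decide. *)
Definition proper_rect (V : rect R d) : Prop := forall j,
  (exists b1 b2, V j = Interval (BSide b1 (lo V j)) (BSide b2 (hi V j))) /\
  [/\ 0 <= lo V j, lo V j < hi V j & hi V j <= 1].

Lemma side_proper (V : rect R d) : proper_rect V -> forall j, 0 < side V j <= 1.
Proof.
by move=> pV j; have [_ [h1 h2 h3]] := pV j; rewrite /side -/(lo V j) -/(hi V j); lra.
Qed.

Lemma sub_in_rect_box (V : rect R d) : proper_rect V ->
  in_rect V `<=` in_rect (box (lo V) (hi V)).
Proof.
move=> pV x h j; have [[b1 [b2 E]] _] := pV j; have := h j.
rewrite E !in_itv /= => /andP[h1 h2].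
by rewrite (lteifW h1) (lteifW h2).
Qed.

Lemma box_sub_in_rect (V : rect R d) (a c : 'I_d -> R) : proper_rect V ->
  (forall j, lo V j < a j) -> (forall j, c j < hi V j) ->
  in_rect (box a c) `<=` in_rect V.
Proof.
move=> pV Va cV x h j; have [[b1 [b2 E]] _] := pV j; have := h j.
rewrite E !in_itv /= => /andP[h1 h2].
by rewrite !lteifS// ?(lt_le_trans (Va j) h1)// (le_lt_trans h2 (cV j)).
Qed.

Definition grid_pt (K : nat) (k : {ffun 'I_d -> 'I_K.+1}) (j : 'I_d) : R :=
  (k j)%:R / K%:R.

Definition grid_volume (K : nat) (l u : {ffun 'I_d -> 'I_K.+1}) : R :=
  \prod_j (grid_pt u j - grid_pt l j).

Lemma grid_pt_ge0 K (k : {ffun 'I_d -> 'I_K.+1}) j : 0 <= grid_pt k j.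
Proof. by rewrite divr_ge0. Qed.

Lemma grid_pt_le1 K (k : {ffun 'I_d -> 'I_K.+1}) j : (0 < K)%N -> grid_pt k j <= 1.
Proof.
by move=> K0; rewrite ler_pdivrMr ?ltr0n// mul1r ler_nat -ltnS ltn_ord.
Qed.

Lemma exists_outer_box (K : nat) (V : rect R d) : (0 < K)%N -> proper_rect V ->
  exists l u : {ffun 'I_d -> 'I_K.+1}, [/\
    forall j, grid_pt l j <= grid_pt u j,
    in_rect V `<=` in_rect (box (grid_pt l) (grid_pt u)) &
    volume V <= grid_volume l u <= volume V + 2 * d%:R / K%:R].
Proof.
move=> K0 pV; have K0R : 0 < K%:R :> R by rewrite ltr0n.
have /fin_all_exists[l hl] j : exists k : 'I_K.+1,
    k%:R / K%:R <= lo V j < k.+1%:R / K%:R.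
  have [_ [h1 h2 h3]] := pV j.
  have [|k [kK h]] := @exists_grid_floor _ K (lo V j) K0; first lra.
  by exists (Ordinal (leqW kK : (k < K.+1)%N)).
have /fin_all_exists[u hu] j : exists k : 'I_K.+1,
    k%:R / K%:R - K%:R^-1 < hi V j <= k%:R / K%:R.
  have [_ [h1 h2 h3]] := pV j.
  (* Rounding [hi] up is rounding [1 - hi] down, hence the reflected index [K - k]. *)
  have [|k [kK h]] := @exists_grid_floor _ K (1 - hi V j) K0; first lra.
  have kK' : (K - k < K.+1)%N by rewrite ltnS leq_subr.
  exists (Ordinal kK') => /=.
  rewrite natrB ?(ltnW kK)// mulrBl divff ?gt_eqF//.
  by move: h; rewrite -natr1 mulrDl mul1r; lra.
exists [ffun j => l j], [ffun j => u j].
have gl j : grid_pt [ffun j => l j] j = (l j)%:R / K%:R by rewrite /grid_pt ffunE.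
have gu j : grid_pt [ffun j => u j] j = (u j)%:R / K%:R by rewrite /grid_pt ffunE.
have il j : grid_pt [ffun j => l j] j <= lo V j < grid_pt [ffun j => l j] j + K%:R^-1.
  by rewrite gl; have := hl j; rewrite -natr1 mulrDl mul1r.
have iu j : hi V j <= grid_pt [ffun j => u j] j < hi V j + K%:R^-1.
  by rewrite gu; have := hu j; lra.
have sV := side_proper pV.
have gap j : side V j <= grid_pt [ffun j => u j] j - grid_pt [ffun j => l j] j <=
    side V j + 2 / K%:R.
  rewrite /side -/(lo V j) -/(hi V j).
  by have := il j; have := iu j; lra.
split.
- by move=> j; have := gap j; have := sV j; lra.
- apply: subset_trans (sub_in_rect_box pV) _ => x h j; have := h j.
  rewrite !in_itv /= => /andP[h1 h2].
  have /andP[h3 _] := il j; have /andP[h4 _] := iu j.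
  by rewrite (le_trans h3 h1) (le_trans h2 h4).
apply/andP; split.
  by apply: ler_prod => j _; have := gap j; have := sV j; lra.
rewrite -lerBlDl /volume /grid_volume.
apply: le_trans (prodrB_le _ _ _ _) _ => [j|j|j|].
- by have := sV j; lra.
- by have := gap j; lra.
- by have := grid_pt_le1 [ffun j => u j] j K0; have := grid_pt_ge0 [ffun j => l j] j; lra.
apply: le_trans (_ : \sum_(j < d) (2 / K%:R) <= _).
  by apply: ler_sum => j _; have := gap j; lra.
by rewrite sumr_const card_ord -[_ *+ d]mulr_natr mulrAC.
Qed.

(** A cell may omit its faces, so the closed inner box must have its corners strictly inside, at the
    cost of up to a full mesh at each end. The sides are at most 1, so each exceeds the volume,
    hence [2 / K], and the rounded ends do not cross. *)
Lemma exists_inner_box (K : nat) (V : rect R d) : (0 < K)%N -> proper_rect V ->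
  2 / K%:R < volume V ->
  exists l u : {ffun 'I_d -> 'I_K.+1}, [/\
    forall j, grid_pt l j <= grid_pt u j,
    in_rect (box (grid_pt l) (grid_pt u)) `<=` in_rect V &
    volume V - 2 * d%:R / K%:R <= grid_volume l u].
Proof.
move=> K0 pV vV; have K0R : 0 < K%:R :> R by rewrite ltr0n.
have /fin_all_exists[l hl] j : exists k : 'I_K.+1,
    k%:R / K%:R - K%:R^-1 <= lo V j < k%:R / K%:R.
  have [_ [h1 h2 h3]] := pV j.
  have [|k [kK h]] := @exists_grid_floor _ K (lo V j) K0; first lra.
  exists (Ordinal (kK : (k.+1 < K.+1)%N)) => /=.
  by move: h; rewrite -natr1 mulrDl mul1r; lra.
have /fin_all_exists[u hu] j : exists k : 'I_K.+1,
    k%:R / K%:R < hi V j <= k%:R / K%:R + K%:R^-1.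
  have [_ [h1 h2 h3]] := pV j.
  have [|k [kK h]] := @exists_grid_floor _ K (1 - hi V j) K0; first lra.
  have kK' : (K - k.+1 < K.+1)%N by rewrite ltnS leq_subr.
  exists (Ordinal kK') => /=.
  rewrite natrB// mulrBl divff ?gt_eqF//.
  by move: h; rewrite -natr1 mulrDl mul1r; lra.
exists [ffun j => l j], [ffun j => u j].
have gl j : grid_pt [ffun j => l j] j = (l j)%:R / K%:R by rewrite /grid_pt ffunE.
have gu j : grid_pt [ffun j => u j] j = (u j)%:R / K%:R by rewrite /grid_pt ffunE.
have sV := side_proper pV.
have gap j : side V j - 2 / K%:R <=
    grid_pt [ffun j => u j] j - grid_pt [ffun j => l j] j <= side V j.
  rewrite /side -/(lo V j) -/(hi V j) gl gu.
  by have := hl j; have := hu j; lra.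
have big j : 2 / K%:R < side V j.
  apply: lt_le_trans vV (prodr_le_factor _ _) => i; have := sV i; lra.
split.
- by move=> j; have := gap j; have := big j; lra.
- apply: box_sub_in_rect => // j.
    by rewrite gl; have := hl j; lra.
  by rewrite gu; have := hu j; lra.
rewrite lerBlDl -lerBlDr /volume /grid_volume.
apply: le_trans (prodrB_le _ _ _ _) _ => [j|j|j|].
- by have := gap j; have := big j; lra.
- by have := gap j; lra.
- by have := sV j; lra.
apply: le_trans (_ : \sum_(j < d) (2 / K%:R) <= _).
  by apply: ler_sum => j _; have := gap j; lra.
by rewrite sumr_const card_ord -[_ *+ d]mulr_natr mulrAC.
Qed.
End proper_rectangles.

(** * Uniform deviation over grid boxes *)

Section uniform_deviation.
Context {disp : measure_display} {Omega : measurableType disp} {R : realType}.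
Variables (P : probability Omega R) (d n : nat) (b M tau : R) (f : vec R d -> R).
Variable X : 'I_n -> Omega -> vec R d.
Hypotheses (d_gt0 : (0 < d)%N) (n_gt0 : (0 < n)%N) (b_gt0 : 0 < b).
Hypothesis tau_gt0 : 0 < tau.
Hypothesis f_bounds : forall y, unit_cube R d y -> b <= f y <= M.
Hypothesis X_measurable : forall i, measurable_fun setT (X i).
Hypothesis X_density : forall i, has_density_on_cube P f (X i).
Hypothesis X_independent :
  mutually_independent P (fun i => generated_by measurable (X i)).

Definition count_in (V : set (vec R d)) (w : Omega) : R := \sum_i \1_V (X i w).

Lemma count_in_le (V W : set (vec R d)) w : V `<=` W -> count_in V w <= count_in W w.
Proof.
move=> VW; apply: ler_sum => i _; rewrite !indicE ler_nat.
by case: (boolP (_ \in V)) => //; rewrite !inE => /VW Wx; rewrite mem_set.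
Qed.

Lemma count_inE (V : set (vec R d)) w :
  count_in V w = \sum_i \1_(X i @^-1` V) w.
Proof. by apply: eq_bigr => i _; rewrite !indicE; congr (_%:R); apply/idP/idP; rewrite !inE. Qed.

Lemma measurable_preimage_data (V : set (vec R d)) i :
  measurable V -> measurable (X i @^-1` V).
Proof. by move=> mV; rewrite -[X in measurable X]setTI; exact: X_measurable. Qed.

Lemma measurable_count_in (V : set (vec R d)) :
  measurable V -> measurable_fun setT (count_in V).
Proof.
move=> mV; rewrite (funext (count_inE V)).
by apply: measurable_count => i; exact: measurable_preimage_data.
Qed.

Lemma data_prob_bigcap (V : set (vec R d)) i0 (J : {set 'I_n}) :
  measurable V ->
  P (\bigcap_(i in [set` J]) (X i @^-1` V)) =
  (fine (P (X i0 @^-1` V)) ^+ #|J|)%:E.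
Proof.
move=> mV; rewrite X_independent => [|i _].
  congr EFin; rewrite -prodr_const; apply: eq_bigr => i _.
  by rewrite (X_density i).2// -(X_density i0).2.
by exists V => //; rewrite setTI.
Qed.

(** With this mesh the total rounding error [2 d / K] is [d / n]. *)
Let K := (2 * n)%N.
Let grid := ({ffun 'I_d -> 'I_K.+1} * {ffun 'I_d -> 'I_K.+1})%type.
Let gbox (p : grid) := in_rect (box (@grid_pt R d K p.1) (grid_pt p.2)).
Let gvol (p : grid) : R := grid_volume p.1 p.2.

(** The Chernoff exponent is useless on tiny boxes, so these are discarded. The factor [3/4] is what
    inward rounding leaves of a cell with [b * volume >= tau]. *)
Definition admissible (p : grid) : bool :=
  [forall j, @grid_pt R d K p.1 j <= grid_pt p.2 j] && (3 / 4 * tau <= b * gvol p).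

Definition deviation (p : grid) : set Omega :=
  if admissible p then
    [set w | count_in (gbox p) w < n%:R * (b * gvol p) / 2] `|`
    [set w | 2 * (n%:R * (M * gvol p)) < count_in (gbox p) w]
  else set0.

Definition some_deviation : set Omega := \bigcup_p deviation p.

Lemma measurable_deviation p : measurable (deviation p).
Proof.
rewrite /deviation; case: ifP => // _.
have m := measurable_count_in (measurable_in_rect (box (@grid_pt R d K p.1) (grid_pt p.2))).
by apply: measurableU; apply: measurable_set_ltr => //; exact: measurable_cst.
Qed.

Lemma measurable_some_deviation : measurable some_deviation.
Proof. by apply: fin_bigcup_measurable => [|p _]; [exact: finite_finset|exact: measurable_deviation]. Qed.

(** On an admissible box the lower tail has exponent at least [n (3/4 tau) / 12 = n tau / 16], the
    upper tail at least twice that since [M >= b] there. *)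
Lemma deviation_prob p :
  fine (P (deviation p)) <= 2 * expR (- (n%:R * tau / 16)).
Proof.
have e0 := expR_ge0 (- (n%:R * tau / 16)).
rewrite /deviation; case: ifP => [|_]; last by rewrite measure0 mulr_ge0.
case/andP => /forallP le vp.
pose i0 := Ordinal n_gt0.
have K0 : (0 < K)%N by rewrite muln_gt0.
have /andP[p1 p2] := density_box_bounds (X_density i0) (ltW b_gt0) f_bounds
  (grid_pt_ge0 p.1) le (fun j => grid_pt_le1 p.2 j K0).
have mG : measurable (gbox p) by exact: measurable_in_rect.
have mA i : measurable (X i @^-1` gbox p) by exact: measurable_preimage_data.
have indep J := data_prob_bigcap i0 J mG.
set q := fine (P (X i0 @^-1` gbox p)) in p1 p2 indep.
have q1 : q <= 1 by rewrite -lee_fin /q fineK ?fin_num_measure// probability_le1.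
have q0 : 0 <= q by exact: fine_prob_ge0.
have v0 : 0 <= b * gvol p by apply: le_trans vp; rewrite mulr_ge0// ltW.
have n0 : 0 <= n%:R :> R by [].
have h : n%:R * (3 / 4 * tau) <= n%:R * (b * gvol p) by rewrite ler_wpM2l.
have hM : n%:R * (b * gvol p) <= n%:R * (M * gvol p).
  by rewrite ler_wpM2l// (le_trans p1).
have nt : 0 <= n%:R * tau by rewrite mulr_ge0// ltW.
have lowP := chernoff_lower (P := P) mA indep (q := b * gvol p).
have highP := chernoff_upper (P := P) mA indep (q := M * gvol p).
rewrite v0 p1 in lowP; rewrite q0 p2 in highP.
have := lowP isT q1; have := highP isT q1 => {lowP highP} highP lowP.
apply: (@le_trans _ _ (fine (P [set w | \sum_i \1_(X i @^-1` gbox p) w < n%:R * (b * gvol p) / 2])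
   + fine (P [set w | 2 * (n%:R * (M * gvol p)) < \sum_i \1_(X i @^-1` gbox p) w]))).
  under eq_set do rewrite count_inE.
  under [X in _ `|` X]eq_set do rewrite count_inE.
  have m1 := measurable_count_lt (n%:R * (b * gvol p) / 2) mA.
  have m2 := measurable_count_gt (2 * (n%:R * (M * gvol p))) mA.
  rewrite -fineD ?fin_num_measure//; apply: fine_le.
  - by rewrite fin_num_measure//; exact: measurableU.
  - by rewrite fin_numD !fin_num_measure.
  - exact: measureU2.
have -> : 2 * expR (- (n%:R * tau / 16)) =
  expR (- (n%:R * tau / 16)) + expR (- (n%:R * tau / 16)) by ring.
apply: lerD; [apply: le_trans lowP _|apply: le_trans highP _]; rewrite ler_expR; lra.
Qed.

Lemma some_deviation_prob :
  fine (P some_deviation) <=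
  2 * (2 * n%:R + 1) ^+ (2 * d) * expR (- (n%:R * tau / 16)).
Proof.
apply: le_trans (prob_bigcup_le P measurable_deviation) _.
apply: le_trans (ler_sum _ (fun p _ => deviation_prob p)) _.
rewrite sumr_const card_prod !card_ffun !card_ord -expnD addnn -mul2n.
rewrite -[_ *+ (_ ^ _)]mulr_natr natrX.
rewrite /K -[(2 * n).+1]addn1 natrD natrM.
by rewrite -!mulrA [expR _ * _]mulrC.
Qed.

(** Compares the cell with an inner box of at least [3/4] of its volume and an outer box of at most
    [5/4]; the factors [1/2] and [2] of the deviation events give [3/8] and [5/2]. *)
Lemma count_in_bounds (V : rect R d) w : ~ some_deviation w -> proper_rect V ->
  tau <= b * volume V -> d%:R / n%:R <= volume V / 4 ->
  3 / 8 * (n%:R * b * volume V) <= count_in (in_rect V) w <=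
  5 / 2 * (n%:R * M * volume V).
Proof.
move=> good pV tV dn.
have n0 : 0 < n%:R :> R by rewrite ltr0n.
have M0 : 0 <= M.
  exact: le_trans ler01 (density_bound_ge1 (X_density (Ordinal n_gt0)) (ltW b_gt0) f_bounds).
have K0 : (0 < K)%N by rewrite muln_gt0.
have KE c : 2 * c / K%:R = c / n%:R :> R.
  by rewrite /K natrM; field; rewrite gt_eqF.
have good' p : admissible p -> n%:R * (b * gvol p) / 2 <= count_in (gbox p) w <=
    2 * (n%:R * (M * gvol p)).
  move=> ap; apply/andP; split; rewrite leNgt; apply/negP => h; apply: good;
    exists p => //; rewrite /deviation ap; [left|right]; exact: h.
have v0 : 0 < volume V by apply: prodr_gt0 => j _; have := side_proper pV j; lra.
apply/andP; split.
  have [|l [u [lu sub hv]]] := exists_inner_box K0 pV.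
    rewrite -[2]mulr1 KE (le_lt_trans _ (_ : volume V / 4 < _))//; last lra.
    by apply: le_trans dn; rewrite ler_pM2r ?invr_gt0// ler1n.
  rewrite KE in hv.
  have hv' : b * (3 / 4 * volume V) <= b * gvol (l, u).
    by rewrite ler_wpM2l ?(ltW b_gt0)//; rewrite /gvol /=; lra.
  have /good'/andP[h _] : admissible (l, u).
    by apply/andP; split; [exact/forallP|lra].
  apply: le_trans (count_in_le w sub); apply: le_trans h.
  have := ler_wpM2l (ltW n0) hv'; lra.
have [l [u [lu sub hv]]] := exists_outer_box K0 pV.
rewrite KE in hv; have /andP[hv1 hv2] := hv.
have hv1' : b * volume V <= b * gvol (l, u) by rewrite ler_wpM2l ?(ltW b_gt0).
have hv2' : M * gvol (l, u) <= M * (5 / 4 * volume V).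
  by rewrite ler_wpM2l// /gvol /=; lra.
have /good'/andP[_ h] : admissible (l, u).
  by apply/andP; split; [exact/forallP|have := tau_gt0; lra].
apply: le_trans (count_in_le w sub) _; apply: le_trans h _.
have := ler_wpM2l (ltW n0) hv2'. lra.
Qed.
End uniform_deviation.

(** * Tree cells *)

Section tree_cells.
Context {R : realType} {d : nat}.
Implicit Types (V : rect R d) (c : Defs.cut R d) (t : tree R d) (x y : vec R d).

(** The order on interval bounds treats open and closed faces uniformly. *)
Lemma in_rectE V x :
  in_rect V x = forall j, ((V j).1 <= BLeft (tnth x j))%O /\ (BRight (tnth x j) <= (V j).2)%O.
Proof.
rewrite /in_rect /=; apply/propext; split => h j; have := h j; case: (V j) => a b /=.
  by rewrite itv_boundlr => /andP.
by rewrite itv_boundlr => -[-> ->].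
Qed.

(** Both children share the same interval bound, and a point lies on exactly one side of it. *)
Lemma in_childP V c x up : in_rect V x ->
  goes_up V c x = up <-> in_rect (child V c up) x.
Proof.
rewrite !in_rectE => Vx; have [h1 h2] := Vx (cut_dir c).
rewrite /goes_up itv_boundlr h2 andbT; split.
  move=> E j; rewrite /child; case: eqP => [->|//]; case: up E => /= E //.
  by split=> //; rewrite leBRight_ltBLeft ltNge E.
move=> /(_ (cut_dir c)); rewrite /child eqxx; case: up => /= -[g1 g2].
  by rewrite g1.
by apply/negbTE; rewrite -ltNge -leBRight_ltBLeft.
Qed.

Lemma proper_unit_rect : proper_rect (@unit_rect R d).
Proof. by move=> j; split; [exists true, false|split; rewrite /lo /hi /=]. Qed.

Lemma proper_child V c up : proper_rect V -> 0 < cut_pos c < 1 ->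
  proper_rect (child V c up).
Proof.
move=> pV /andP[p0 p1] j; have [[b1 [b2 E]] [h1 h2 h3]] := pV j.
rewrite /lo /hi /child; case: eqP => [jE|_]; last first.
  by split; [exists b1, b2; rewrite E|split].
have s0 : 0 < side V j by rewrite /side subr_gt0.
have m1 : 0 < cut_pos c * side V j by rewrite mulr_gt0.
have m2 : cut_pos c * side V j < side V j by rewrite gtr_pMl.
move: m2; rewrite {2}/side -/(lo V j) -/(hi V j) => m2.
case: up; rewrite /= -jE -/(lo V j) -/(hi V j) E /=; split.
- by exists (cut_bit c), b2; rewrite /cut_bound -jE.
- by split; lra.
- by exists b1, (cut_bit c); rewrite /cut_bound -jE.
- by split; lra.
Qed.

Lemma child_sub V c up : proper_rect V -> 0 < cut_pos c < 1 ->
  in_rect (child V c up) `<=` in_rect V.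
Proof.
move=> pV /andP[p0 p1] x; rewrite !in_rectE => h j; move: (h j) => {h}; rewrite /child.
case: eqP => [jE|//]; have [[b1 [b2 E]] [h1 h2 h3]] := pV j.
have s0 : 0 < side V j by rewrite /side subr_gt0.
have m1 : 0 < cut_pos c * side V j by rewrite mulr_gt0.
have m2 : cut_pos c * side V j < side V j by rewrite gtr_pMl.
move: m2; rewrite {2}/side -/(lo V j) -/(hi V j) => m2.
case: up => /= -[g1 g2]; split => //.
  apply: le_trans g1; rewrite E /cut_bound -jE /= -/(lo V j).
  by apply: ltW; rewrite ltBSide; apply: lteifS; lra.
apply: le_trans g2 _; rewrite E /cut_bound -jE /= -/(lo V j).
by apply: ltW; rewrite ltBSide; apply: lteifS; lra.
Qed.

(* Cells are indexed by reversed addresses, so that the last cut is the head. *)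
Fixpoint cell_at t (r : seq bool) : rect R d :=
  if r is up :: r' then child (cell_at t r') (t (rev r')) up else unit_rect R d.

Definition path_of t x i : seq bool := (descend t x i).1.

Lemma size_path_of t x i : size (path_of t x i) = i.
Proof.
elim: i => //= i; rewrite /path_of /=; case: (descend t x i) => s V /= <-.
by rewrite size_rcons.
Qed.

Lemma cell_path_of t x i : cell t x i = cell_at t (rev (path_of t x i)).
Proof.
elim: i => //= i; rewrite /cell /path_of /=; case: (descend t x i) => s V /= ->.
by rewrite rev_rcons /= revK.
Qed.

Lemma path_ofS t x i : path_of t x i.+1 =
  rcons (path_of t x i) (goes_up (cell t x i) (t (path_of t x i)) x).
Proof. by rewrite /path_of /cell /=; case: (descend t x i). Qed.

Lemma directionE t x i : direction t x i = cut_dir (t (path_of t x i)).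
Proof. by []. Qed.

Lemma cellS t x i : cell t x i.+1 = child (cell t x i) (t (path_of t x i))
  (goes_up (cell t x i) (t (path_of t x i)) x).
Proof. by rewrite /path_of /cell /=; case: (descend t x i). Qed.

Lemma in_cell t x i : unit_cube R d x -> in_rect (cell t x i) x.
Proof. by move=> x01; elim: i => // i IH; rewrite cellS; apply/in_childP. Qed.

Variables (N : nat) (t : tree R d).
Hypothesis t_pos : forall s, (size s < N)%N -> 0 < cut_pos (t s) < 1.

Lemma proper_cell_at r : (size r <= N)%N -> proper_rect (cell_at t r).
Proof.
elim: r => [_|up r IH /= rN]; first exact: proper_unit_rect.
by apply: proper_child; [exact/IH/ltnW|rewrite t_pos// size_rev].
Qed.

Lemma proper_cell x i : (i <= N)%N -> proper_rect (cell t x i).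
Proof.
by move=> iN; rewrite cell_path_of; apply: proper_cell_at; rewrite size_rev size_path_of.
Qed.

(** Cells are nested: membership in the child fixes the prefix by induction and the last turn by
    [in_childP]. This makes path events measurable and identifies an address with the path of any
    point of its cell. *)
Lemma path_ofP x s : unit_cube R d x -> (size s <= N)%N ->
  path_of t x (size s) = s <-> in_rect (cell_at t (rev s)) x.
Proof.
move=> x01 sN; split => [<-|].
  by rewrite -cell_path_of; exact: in_cell.
elim/last_ind: s sN => // s up IH; rewrite size_rcons rev_rcons /= => sN h.
have sub : in_rect (cell_at t (rev s)) x.
  apply: child_sub h; last by rewrite revK t_pos.
  by apply: proper_cell_at; rewrite size_rev ltnW.
have E := IH (ltnW sN) sub.
rewrite path_ofS E cell_path_of E; congr rcons.
by apply/in_childP => //; rewrite revK in h.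
Qed.

Lemma proper_nonempty V : proper_rect V -> exists y, unit_cube R d y /\ in_rect V y.
Proof.
move=> pV; exists [tuple (lo V j + hi V j) / 2 | j < d]; split => j.
  have [_ [h1 h2 h3]] := pV j.
  by rewrite tnth_mktuple in_itv /=; apply/andP; split; lra.
have [[b1 [b2 E]] [h1 h2 h3]] := pV j.
rewrite tnth_mktuple E in_itv /=; apply/andP; split; apply: lteifS; lra.
Qed.

(** Replaces the uncountable family of points by finitely many addresses: every cell contains its
    midpoint, so every address is the path of some point. *)
Lemma tree_regularP mu alpha : tree_regular mu alpha N t <->
  forall i : 'I_N, forall s : i.-tuple bool, forall up : bool,
    alpha * mu (in_rect (cell_at t (rev s))) <= mu (in_rect (cell_at t (up :: rev s))).
Proof.
split => [reg i s up|reg y y01 i iN].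
  have sz : size (rcons s up) = i.+1 by rewrite size_rcons size_tuple.
  have [|y [y01 yV]] := @proper_nonempty (cell_at t (up :: rev s)).
    by apply: proper_cell_at; rewrite /= size_rev size_tuple.
  have := reg y y01 i (ltn_ord i).
  have /(path_ofP y01) : (size (rcons s up) <= N)%N by rewrite sz.
  rewrite rev_rcons => -[_ /(_ yV)]; rewrite sz => E.
  rewrite !cell_path_of E rev_rcons.
  by have := path_ofS t y i; rewrite E => /rcons_inj[<- _].
rewrite !cell_path_of path_ofS rev_rcons.
have sz : size (path_of t y i) == i by rewrite size_path_of.
exact: (reg (Ordinal iN) (Tuple sz)).
Qed.

Lemma side_cellS x i j : (i < N)%N ->
  side (cell t x i.+1) j =
  (if direction t x i == j then position t x i else 1) * side (cell t x i) j.
Proof.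
move=> iN; have /andP[s0 _] := side_proper (proper_cell x (ltnW iN)) j.
case: eqP => [<-|ne]; first by rewrite divfK// gt_eqF// directionE;
  have /andP[] := side_proper (proper_cell x (ltnW iN)) (cut_dir (t (path_of t x i))).
rewrite mul1r cellS /side /child.
by case: eqP => // jE; case: ne; rewrite directionE jE.
Qed.

Lemma side_cell x i j : (i <= N)%N ->
  side (cell t x i) j =
  \prod_(k < i) (if direction t x k == j then position t x k else 1).
Proof.
elim: i => [_|i IH iN]; first by rewrite big_ord0 /side /= subr0.
by rewrite side_cellS// big_ord_recr /= IH 1?ltnW// mulrC.
Qed.

Lemma volume_cellS x i : (i < N)%N ->
  volume (cell t x i.+1) = position t x i * volume (cell t x i).
Proof.
move=> iN; rewrite /volume (eq_bigr _ (fun j _ => side_cellS x j iN)) big_split /=.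
congr (_ * _); rewrite (bigD1 (direction t x i))//= eqxx big1 ?mulr1// => j.
by rewrite eq_sym => /negbTE ->.
Qed.

End tree_cells.

(** * Measurability of random trees *)

Section rectangle_shape.
Context {R : realType} {d : nat}.
Implicit Type V : rect R d.

Lemma side_le_h_plus V j : side V j <= h_plus V.
Proof. exact: le_bigmax. Qed.

Lemma h_minus_le_side V j : h_minus V <= side V j.
Proof. exact: bigmin_le. Qed.

Lemma h_minus_gt0 V : (0 < d)%N -> proper_rect V -> 0 < h_minus V.
Proof.
move=> d0 pV; have s0 j : 0 < side V j by have /andP[] := side_proper pV j.
by apply/bigmin_gtP; split => //; exact: lt_le_trans (side_le_h_plus V (Ordinal d0)).
Qed.

(** The pair need not realise the extreme sides, and either order is allowed; so a lower bound on
    the absolute log-ratio along two fixed axes suffices. *)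
Lemma expR_ln_side_le_shape V i j : (0 < d)%N -> proper_rect V ->
  expR (ln (side V i) - ln (side V j)) <= h_plus V / h_minus V.
Proof.
move=> d0 pV; have s0 k : side V k \is Num.pos.
  by rewrite posrE; have /andP[] := side_proper pV k.
rewrite expRB !lnK//; apply: ler_pM.
- by rewrite ltW// -posrE.
- by rewrite invr_ge0 ltW// -posrE.
- exact: side_le_h_plus.
- by rewrite lef_pV2// ?h_minus_le_side// posrE h_minus_gt0.
Qed.
End rectangle_shape.

Section measurable_extrema.
Context {disp : measure_display} {Omega : measurableType disp} {R : realType}.

Lemma measurable_bigmaxr (I : Type) (s : seq I) (g : Omega -> R) (F : I -> Omega -> R) :
  measurable_fun setT g -> (forall i, measurable_fun setT (F i)) ->
  measurable_fun setT (fun w => \big[Num.max/g w]_(i <- s) F i w).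
Proof.
move=> mg mF; elim: s => [|i s IH]; first by under eq_fun do rewrite big_nil.
by under eq_fun do rewrite big_cons; exact: measurable_maxr.
Qed.

Lemma measurable_bigminr (I : Type) (s : seq I) (g : Omega -> R) (F : I -> Omega -> R) :
  measurable_fun setT g -> (forall i, measurable_fun setT (F i)) ->
  measurable_fun setT (fun w => \big[Num.min/g w]_(i <- s) F i w).
Proof.
move=> mg mF; elim: s => [|i s IH]; first by under eq_fun do rewrite big_nil.
by under eq_fun do rewrite big_cons; exact: measurable_minr.
Qed.
End measurable_extrema.

Section random_tree_measurability.
Context {disp : measure_display} {Omega : measurableType disp} {R : realType}.
Variables (P : probability Omega R) (d N : nat) (t : Omega -> tree R d).
Hypothesis t_random : is_random_tree N t.

Lemma measurable_set_true (g : Omega -> bool) :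
  measurable_fun setT g -> measurable [set w | g w].
Proof.
move=> mg; rewrite -[X in measurable X]setTI.
rewrite (_ : [set w | g w] = g @^-1` [set true]).
  exact: mg.
by apply/seteqP; split.
Qed.

Lemma measurable_cut_dir s j : (size s < N)%N ->
  measurable_fun setT (fun w => cut_dir (t w s) == j).
Proof.
move=> sN; have [/(_ j) mD _ _ _] := t_random sN.
apply: (measurable_fun_bool true).
rewrite setTI (_ : _ @^-1` _ = [set w | cut_dir (t w s) = j])//.
by apply/seteqP; split => w /= /eqP.
Qed.

Lemma measurable_cell_bounds r : (size r <= N)%N -> forall j,
  measurable_fun setT (fun w => lo (cell_at (t w) r) j) /\
  measurable_fun setT (fun w => hi (cell_at (t w) r) j).
Proof.
elim: r => [_ j|up r IH /= rN j].
  by split; exact: measurable_cst.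
have [m1 m2] := IH (ltnW rN) j.
have sN : (size (rev r) < N)%N by rewrite size_rev.
have mD := measurable_cut_dir j sN.
have [_ mp _ _] := t_random sN.
have mm : measurable_fun setT (fun w => lo (cell_at (t w) r) j +
    cut_pos (t w (rev r)) * side (cell_at (t w) r) j).
  by apply: measurable_funD => //; apply: measurable_funM => //; exact: measurable_funB.
rewrite /lo /hi /child; split.
  rewrite (_ : (fun w => _) = (fun w => if cut_dir (t w (rev r)) == j then
    (if up then lo (cell_at (t w) r) j +
      cut_pos (t w (rev r)) * side (cell_at (t w) r) j else lo (cell_at (t w) r) j)
    else lo (cell_at (t w) r) j)); last first.
    apply/funext => w; rewrite eq_sym; case: eqP => // <-.
    by case: up.
  by apply: measurable_fun_ifT => //; case: up.
rewrite (_ : (fun w => _) = (fun w => if cut_dir (t w (rev r)) == j then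
  (if up then hi (cell_at (t w) r) j else lo (cell_at (t w) r) j +
      cut_pos (t w (rev r)) * side (cell_at (t w) r) j)
  else hi (cell_at (t w) r) j)); last first.
  apply/funext => w; rewrite eq_sym; case: eqP => // <-.
  by case: up.
by apply: measurable_fun_ifT => //; case: up.
Qed.

Lemma measurable_side_cell_at r j : (size r <= N)%N ->
  measurable_fun setT (fun w => side (cell_at (t w) r) j).
Proof.
by move=> rN; have [m1 m2] := measurable_cell_bounds rN j; exact: measurable_funB.
Qed.

(** The point is random too, because regularity counts data points in random cells. Instead of a
    sigma-algebra on rectangles, the two endpoint comparisons in each coordinate are followed down
    the address, the cut bit deciding between [<=] and [<]. *)
Lemma measurable_in_cell_at (Y : Omega -> vec R d) r : (size r <= N)%N ->
  measurable_fun setT Y -> measurable [set w | in_rect (cell_at (t w) r) (Y w)].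
Proof.
move=> rN mY.
have mYj j : measurable_fun setT (fun w => tnth (Y w) j : R).
  by have := measurableT_comp (measurable_tnth j) mY.
suff H j : measurable_fun setT (fun w => ((cell_at (t w) r j).1 <= BLeft (tnth (Y w) j))%O) /\
           measurable_fun setT (fun w => (BRight (tnth (Y w) j) <= (cell_at (t w) r j).2)%O).
  rewrite (_ : [set w | _] = \bigcap_(j in [set: 'I_d])
     ([set w | ((cell_at (t w) r j).1 <= BLeft (tnth (Y w) j))%O] `&`
      [set w | (BRight (tnth (Y w) j) <= (cell_at (t w) r j).2)%O])).
    apply: fin_bigcap_measurable => // j _; have [h1 h2] := H j.
    by apply: measurableI; exact: measurable_set_true.
  apply/seteqP; split => w /=; rewrite in_rectE => h j; first by move=> _; exact: h.
  exact: h.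
elim: r rN => [_|up r IH /= rN].
  split; rewrite /=.
    rewrite (_ : (fun w => _) = (fun w => 0 <= (tnth (Y w) j : R))).
      by apply: measurable_fun_ler.
    by apply/funext => w; rewrite leBSide.
  rewrite (_ : (fun w => _) = (fun w => (tnth (Y w) j : R) <= 1)).
    by apply: measurable_fun_ler.
  by apply/funext => w; rewrite leBSide.
have [g1 g2] := IH (ltnW rN).
have [m1 m2] := measurable_cell_bounds (ltnW rN) j.
have sN : (size (rev r) < N)%N by rewrite size_rev.
have mD := measurable_cut_dir j sN.
have [_ mp mb _] := t_random sN.
set m := fun w => lo (cell_at (t w) r) j +
    cut_pos (t w (rev r)) * side (cell_at (t w) r) j.
have mm : measurable_fun setT m.
  by apply: measurable_funD => //; apply: measurable_funM => //; exact: measurable_funB.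
rewrite /child; split.
  rewrite (_ : (fun w => _) = (fun w => if cut_dir (t w (rev r)) == j then
    (if up then (if cut_bit (t w (rev r)) then m w <= (tnth (Y w) j : R) else
      m w < (tnth (Y w) j : R))
      else ((cell_at (t w) r j).1 <= BLeft (tnth (Y w) j))%O)
    else ((cell_at (t w) r j).1 <= BLeft (tnth (Y w) j))%O)); last first.
    apply/funext => w; rewrite eq_sym; case: eqP => // E.
    case: up => //=; rewrite leBSide /= E.
    by case: (cut_bit _).
  apply: measurable_fun_ifT => //; case: up => //.
  by apply: measurable_fun_ifT => //; [exact: measurable_fun_ler|exact: measurable_fun_ltr].
rewrite (_ : (fun w => _) = (fun w => if cut_dir (t w (rev r)) == j then
    (if up then (BRight (tnth (Y w) j) <= (cell_at (t w) r j).2)%O else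
      (if cut_bit (t w (rev r)) then (tnth (Y w) j : R) < m w else
      (tnth (Y w) j : R) <= m w))
    else (BRight (tnth (Y w) j) <= (cell_at (t w) r j).2)%O)); last first.
  apply/funext => w; rewrite eq_sym; case: eqP => // E.
  case: up => //=; rewrite leBSide /= E.
  by case: (cut_bit _).
apply: measurable_fun_ifT => //; case: up => //.
by apply: measurable_fun_ifT => //; [exact: measurable_fun_ltr|exact: measurable_fun_ler].
Qed.

Lemma t_pos w s : (size s < N)%N -> 0 < cut_pos (t w s) < 1.
Proof. by move=> /t_random[]. Qed.

Variable x : vec R d.
Hypothesis x_cube : unit_cube R d x.

Lemma measurable_path_of s : (size s <= N)%N ->
  measurable [set w | path_of (t w) x (size s) = s].
Proof.
move=> sN; rewrite (_ : [set w | _] = [set w | in_rect (cell_at (t w) (rev s)) x]).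
  by apply: measurable_in_cell_at; [rewrite size_rev|exact: measurable_cst].
by apply/seteqP; split => w /= /(path_ofP (@t_pos w) x_cube sN).
Qed.

(** The cell of [x] has a random address, but only finitely many are possible; once the address is
    fixed, the event concerns fixed nodes. *)
Lemma measurable_by_path i (Q : Omega -> Prop) (A : i.-tuple bool -> set Omega) :
  (i <= N)%N -> (forall s, measurable (A s)) ->
  (forall w (s : i.-tuple bool), path_of (t w) x i = s -> Q w <-> A s w) ->
  measurable [set w | Q w].
Proof.
move=> iN mA QA; rewrite (_ : [set w | Q w] =
  \bigcup_(s : i.-tuple bool) ([set w | path_of (t w) x (size s) = s] `&` A s)).
  apply: fin_bigcup_measurable => // s _; apply: measurableI => //.
  by apply: measurable_path_of; rewrite size_tuple.
apply/seteqP; split => w /=.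
  have sz : size (path_of (t w) x i) == i by rewrite size_path_of.
  move=> Qw; exists (Tuple sz) => //; split => /=; first by rewrite (eqP sz).
  by apply/(QA w (Tuple sz)).
by move=> [s _ [/=]]; rewrite size_tuple => /QA E /E.
Qed.

Lemma measurable_direction i j : (i < N)%N ->
  measurable [set w | direction (t w) x i = j].
Proof.
move=> iN; apply: (@measurable_by_path i _ (fun s => [set w | cut_dir (t w s) = j])).
- exact: ltnW.
- by move=> s; have [|h _ _ _] := @t_random s; [rewrite size_tuple|exact: h].
- by move=> w s; rewrite directionE => ->.
Qed.

Lemma measurable_side_cell i j : (i <= N)%N ->
  measurable_fun setT (fun w => side (cell (t w) x i) j).
Proof.
move=> iN _ B mB; rewrite setTI.
apply: (@measurable_by_path i _ (fun s => [set w | B (side (cell_at (t w) (rev s)) j)])) => //.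
  move=> s; rewrite -[X in measurable X]setTI.
  by apply: measurable_side_cell_at => //; rewrite size_rev size_tuple.
by move=> w s E; rewrite /preimage /= cell_path_of E.
Qed.

Lemma measurable_position i : (i < N)%N ->
  measurable_fun setT (fun w => position (t w) x i).
Proof.
move=> iN _ B mB; rewrite setTI.
rewrite (_ : _ @^-1` B = \bigcup_j ([set w | direction (t w) x i = j] `&`
  [set w | B (side (cell (t w) x i.+1) j / side (cell (t w) x i) j)])).
  apply: fin_bigcup_measurable => // j _; apply: measurableI.
    exact: measurable_direction.
  rewrite -[X in measurable X]setTI.
  have mf : measurable_fun setT (fun w => side (cell (t w) x i.+1) j / side (cell (t w) x i) j).
    apply: measurable_funM; first exact: measurable_side_cell.
    (* The reciprocal of a nonnegative side is a power, and powers are measurable. *)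
    rewrite (_ : (fun w => _) = (fun w => side (cell (t w) x i) j `^ (-1))).
      apply: (measurableT_comp (@measurable_powR R (-1))).
      exact/measurable_side_cell/ltnW.
    apply/funext => w; rewrite powR_inv1//.
    by have /andP[/ltW] := side_proper (proper_cell (@t_pos w) x (ltnW iN)) j.
  exact: mf.
apply/seteqP; split => w /=; first by move=> h; exists (direction (t w) x i).
by move=> [j _ [<-]].
Qed.


Lemma measurable_tree_regular (n : nat) (X : 'I_n -> Omega -> vec R d) alpha :
  (forall i, measurable_fun setT (X i)) ->
  measurable [set w | tree_regular (empirical X w) alpha N (t w)].
Proof.
move=> mX.
have mE r : (size r <= N)%N ->
    measurable_fun setT (fun w => empirical X w (in_rect (cell_at (t w) r))).
  move=> rN; apply: measurable_funM => //; apply: measurable_sum => i.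
  rewrite (_ : (fun w => _) = \1_[set w | in_rect (cell_at (t w) r) (X i w)]).
    by apply: measurable_indic; exact: measurable_in_cell_at.
  by apply/funext => w; rewrite !indicE; congr (_%:R); apply/idP/idP; rewrite !inE.
rewrite (_ : [set w | _] = \bigcap_(i in [set: 'I_N])
  \bigcap_(s in [set: i.-tuple bool]) \bigcap_(up in [set: bool])
  [set w | alpha * empirical X w (in_rect (cell_at (t w) (rev s))) <=
           empirical X w (in_rect (cell_at (t w) (up :: rev s)))]).
  apply: fin_bigcap_measurable => // i _; apply: fin_bigcap_measurable => // s _.
  apply: fin_bigcap_measurable => // up _; apply: measurable_set_ler.
    apply: measurable_funM => //; apply: mE.
    by rewrite size_rev size_tuple ltnW.
  by apply: mE; rewrite /= size_rev size_tuple.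
apply/seteqP; split => w /=.
  by move=> /(tree_regularP (@t_pos w)) h i _ s _ up _; exact: h.
by move=> h; apply/(tree_regularP (@t_pos w)) => i s up; exact: h.
Qed.

Lemma measurable_cell_ratio c : (0 < d)%N ->
  measurable [set w | c <= h_plus (cell (t w) x N) / h_minus (cell (t w) x N)].
Proof.
move=> d0.
have mS j := measurable_side_cell j (leqnn N).
have mP : measurable_fun setT (fun w => h_plus (cell (t w) x N)).
  by apply: measurable_bigmaxr => //; exact: measurable_cst.
have mM : measurable_fun setT (fun w => h_minus (cell (t w) x N)).
  exact: measurable_bigminr.
rewrite (_ : [set w | _] = [set w | c * h_minus (cell (t w) x N) <= h_plus (cell (t w) x N)]).
  by apply: measurable_set_ler => //; exact: measurable_funM.
apply/seteqP; split => w /=; rewrite ler_pdivlMr//.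
all: exact: (h_minus_gt0 d0 (proper_cell (@t_pos w) x (leqnn N))).
Qed.

End random_tree_measurability.

(** * The shape event *)

Lemma ln_prod {R : realType} (n : nat) (F : 'I_n -> R) :
  (forall i, 0 < F i) -> ln (\prod_i F i) = \sum_i ln (F i).
Proof.
move=> F0; apply: expR_inj; rewrite expR_sum lnK ?posrE ?prodr_gt0//.
by apply: eq_bigr => i _; rewrite lnK ?posrE.
Qed.

Section shape_event.
Context {disp : measure_display} {Omega : measurableType disp} {R : realType}.
Variables (P : probability Omega R) (d N : nat) (rho : R) (t : Omega -> tree R d).
Variables (x : vec R d) (a0 a1 : 'I_d).
Hypothesis a01 : a0 != a1.
Hypotheses (N_gt0 : (0 < N)%N) (rho_bounds : 0 < rho <= 1 / 2).
Hypothesis t_random : is_random_tree N t.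
Hypothesis x_cube : unit_cube R d x.
Hypothesis DU_independent :
  independent2 P (generated_by setT (directions N t x))
                 (generated_by measurable (positions N t x)).
Hypothesis D_independent : mutually_independent P
  (fun i : 'I_N => generated_by setT (fun w => direction (t w) x i)).
Hypothesis D_uniform : forall (i : 'I_N) (j : 'I_d),
  P [set w | direction (t w) x i = j] = (d%:R^-1)%:E.
Hypothesis U_bounds : forall (i : 'I_N) (w : Omega),
  rho <= position (t w) x i <= 1 - rho.

Let d_gt1 : (1 < d)%N.
Proof.
case: d a0 a1 a01 => [[]//|[|//]] b0 b1.
by rewrite (ord1 b0) (ord1 b1) eqxx.
Qed.

(** For [u] in [[rho, 1 - rho]], [- ln u] ranges over [[l, nu * l]], the hypothesis of the
    anticoncentration lemma. *)
Let l : R := - ln (1 - rho).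
Let nu : R := ln rho / ln (1 - rho).

Lemma log_width_gt0 : 0 < l.
Proof. by rewrite /l oppr_gt0 ln_lt0//; have := rho_bounds; lra. Qed.

Lemma log_ratio_ge1 : 1 <= nu.
Proof.
have l0 := log_width_gt0; rewrite /nu -mulrNN -invrN ler_pdivlMr// mul1r lerN2.
by rewrite ler_ln ?posrE; have := rho_bounds; lra.
Qed.

Let nu_l : nu * l = - ln rho.
Proof.
rewrite /nu /l mulrN divfK// lt_eqF// -oppr_gt0; exact: log_width_gt0.
Qed.

Definition log_positions (u : N.-tuple (measurableTypeR R)) (i : nat) : R :=
  - ln (nth 0 u i).

(** Indexed by the direction word: for a fixed word the event constrains the positions only, so
    independence factorises each slice [joint D]. *)
Definition wide_positions (D : N.-tuple 'I_d) : set (N.-tuple (measurableTypeR R)) :=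
  [set u | N%:R / d%:R * l ^+ 2 <= signed_sum a0 a1 (log_positions u) D ^+ 2].

Lemma measurable_wide_positions D : measurable (wide_positions D).
Proof.
apply: measurable_set_ler; first exact: measurable_cst.
apply: measurable_funX; apply: measurable_sum => i.
apply: measurable_funM => //; rewrite /log_positions.
apply: measurableT_comp => //; apply: measurableT_comp; first exact: measurable_ln.
rewrite (_ : (fun u => _) = (fun u => tnth u i)); first exact: measurable_tnth.
by apply/funext => u; rewrite (tnth_nth 0).
Qed.

Definition shape_event : set Omega :=
  [set w | wide_positions (directions N t x w) (positions N t x w)].

Let joint D := [set w | directions N t x w = D] `&` positions N t x @^-1` wide_positions D.

Lemma measurable_positions : measurable_fun setT (positions N t x).
Proof.
apply/measurable_fun_tnthP => i; rewrite (_ : _ \o _ = fun w => position (t w) x i).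
  by apply: measurable_position => //.
by apply/funext => w /=; rewrite tnth_mktuple.
Qed.

Lemma measurable_wide_event D : measurable (positions N t x @^-1` wide_positions D).
Proof.
rewrite -[X in measurable X]setTI; apply: measurable_positions => //.
exact: measurable_wide_positions.
Qed.

Lemma directionsE D : [set w | directions N t x w = D] =
  \bigcap_(i in [set` [set: 'I_N]%SET]) [set w | direction (t w) x i = tnth D i].
Proof.
apply/seteqP; split => w /=.
  by move=> <- i _ /=; rewrite tnth_mktuple.
move=> h; apply: eq_from_tnth => i; rewrite tnth_mktuple; apply: h => /=.
by rewrite inE.
Qed.

Lemma measurable_directions D : measurable [set w | directions N t x w = D].
Proof.
rewrite directionsE; apply: fin_bigcap_measurable => // i _.
exact: (measurable_direction t_random x_cube _ (ltn_ord i)).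
Qed.

Lemma measurable_joint D : measurable (joint D).
Proof. by apply: measurableI; [exact: measurable_directions|exact: measurable_wide_event]. Qed.

Lemma prob_directions D : P [set w | directions N t x w = D] = (d%:R ^- N)%:E.
Proof.
rewrite directionsE D_independent => [|i _].
  rewrite (eq_bigr (fun=> d%:R^-1)); last by move=> i _; rewrite D_uniform.
  by rewrite prodr_const cardsT card_ord exprVn.
by exists [set tnth D i] => //; rewrite setTI.
Qed.

Lemma prob_joint D : fine (P (joint D)) =
  d%:R ^- N * fine (P (positions N t x @^-1` wide_positions D)).
Proof.
rewrite /joint DU_independent.
- by rewrite prob_directions fineM ?fin_num_measure//; exact: measurable_wide_event.
- by exists [set D] => //; rewrite setTI.
- exists (wide_positions D); last by rewrite setTI.
  exact: measurable_wide_positions.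
Qed.

Lemma shape_eventE : shape_event = \bigcup_D joint D.
Proof.
apply/seteqP; split => w; first by move=> h; exists (directions N t x w).
by move=> [D _ [/= <-]].
Qed.

Lemma measurable_shape_event : measurable shape_event.
Proof.
rewrite shape_eventE; apply: fin_bigcup_measurable => // D _.
exact: measurable_joint.
Qed.

(** The slices sum to the expectation, over the positions alone, of a mean over all direction words;
    anticoncentration bounds that mean for every outcome. *)
Lemma shape_event_prob : nu ^- 4 / (8 * d%:R) <= fine (P shape_event).
Proof.
apply: (@le_trans _ _ (\sum_D fine (P (joint D)))).
  under eq_bigr do rewrite prob_joint.
  rewrite -[leLHS]mulr1 -[X in _ * X <= _]/(fine 1%:E) -(probability_setT P).
  apply: prob_indic_le => //; first exact: measurable_wide_event.
  (* The positions are frozen at [w] while [D] runs over all words, unrelated to the directions at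
     [w]. *)
  move=> w; rewrite indicT mulr1.
  have hL i : (i < N)%N -> l <= log_positions (positions N t x w) i <= nu * l.
    move=> iN; rewrite nu_l /log_positions /l.
    rewrite -[i]/(val (Ordinal iN)) -tnth_nth tnth_mktuple.
    have := U_bounds (Ordinal iN) w => /=; set u := position _ _ _ => hu.
    by rewrite !lerN2 !ler_ln ?posrE; have := rho_bounds; lra.
  apply: le_trans (signed_sum_anticoncentration a01 N_gt0 log_width_gt0
    log_ratio_ge1 hL d_gt1) _.
  rewrite /tuple_mean mulr_sumr; apply: ler_sum => D _.
  rewrite ler_wpM2l ?invr_ge0 ?exprn_ge0// indicE ler_nat.
  case: (boolP (_ <= _)) => // h; rewrite mem_set//.
(* The slices are disjoint, as [w] has only one direction word; negating both sides brings the
   inequality into the form of [prob_indic_le]. *)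
rewrite -lerN2 -mulN1r -sumrN.
under eq_bigr do rewrite -mulN1r.
apply: prob_indic_le => //; first exact: measurable_joint.
- exact: measurable_shape_event.
- move=> w; rewrite -mulr_sumr !mulN1r lerN2 (bigD1 (directions N t x w))//=.
  rewrite big1 ?addr0 => [|D DE]; last first.
    rewrite indicE memNset// => -[/= E]; by rewrite E eqxx in DE.
  rewrite !indicE ler_nat; case: (boolP (w \in joint _)) => //.
  by rewrite inE => -[_ h]; rewrite mem_set.
Qed.

Lemma shape_event_ratio w : shape_event w ->
  (1 - rho) `^ (- Num.sqrt (N%:R / d%:R)) <=
  h_plus (cell (t w) x N) / h_minus (cell (t w) x N).
Proof.
move=> sw; have pV : proper_rect (cell (t w) x N) by exact: proper_cell (t_pos t_random w) _ _ _.
have d0 : (0 < d)%N by exact: ltnW.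
have l0 := log_width_gt0.
have u0 i : (i < N)%N -> 0 < position (t w) x i.
  by move=> iN; have := U_bounds (Ordinal iN) w => /=; have := rho_bounds; lra.
have lnS j : ln (side (cell (t w) x N) j) =
    \sum_(k < N) (direction (t w) x k == j)%:R * ln (position (t w) x k).
  rewrite (side_cell (t_pos t_random w))// ln_prod; last first.
    by move=> k; case: ifP => // _; exact: u0.
  by apply: eq_bigr => k _; case: eqP => _; rewrite ?mul1r// mul0r ln1.
have sE : signed_sum a0 a1 (log_positions (positions N t x w)) (directions N t x w) =
    ln (side (cell (t w) x N) a1) - ln (side (cell (t w) x N) a0).
  rewrite !lnS -sumrB; apply: eq_bigr => k _.
  rewrite /log_positions -tnth_nth !tnth_mktuple /direction_sign; ring.
have hs : Num.sqrt (N%:R / d%:R) * l <=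
    `|ln (side (cell (t w) x N) a1) - ln (side (cell (t w) x N) a0)|.
  rewrite -sE -sqrtr_sqr -[l](ger0_norm (ltW l0)) -sqrtr_sqr -sqrtrM ?divr_ge0//.
  by rewrite ler_wsqrtr.
have -> : (1 - rho) `^ (- Num.sqrt (N%:R / d%:R)) = expR (Num.sqrt (N%:R / d%:R) * l).
  rewrite /powR gt_eqF ?mulNr ?mulrN//; have := rho_bounds; lra.
(* The sign of the log-ratio tells which of the two sides goes in the numerator. *)
case: (lerP 0 (ln (side (cell (t w) x N) a1) - ln (side (cell (t w) x N) a0))) => s.
  rewrite ger0_norm// in hs.
  by apply: le_trans (expR_ln_side_le_shape a1 a0 d0 pV); rewrite ler_expR.
rewrite ltr0_norm// opprB in hs.
by apply: le_trans (expR_ln_side_le_shape a0 a1 d0 pV); rewrite ler_expR.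
Qed.
End shape_event.

(** * Regularity *)

Section regularity.
Context {disp : measure_display} {Omega : measurableType disp} {R : realType}.
Variables (P : probability Omega R) (d n N : nat) (b M rho : R) (f : vec R d -> R).
Variables (X : 'I_n -> Omega -> vec R d) (t : Omega -> tree R d).
Hypotheses (d_gt0 : (0 < d)%N) (n_gt0 : (0 < n)%N) (N_gt0 : (0 < N)%N) (b_gt0 : 0 < b).
Hypothesis f_bounds : forall y, unit_cube R d y -> b <= f y <= M.
Hypothesis X_density : forall i, has_density_on_cube P f (X i).
Hypothesis t_random : is_random_tree N t.
Hypothesis rho_bounds : 0 < rho <= 1.
Hypothesis U_bounds : forall y, unit_cube R d y -> forall (i : 'I_N) (w : Omega),
  rho <= position (t w) y i.

Let tau : R := (b * rho / M) ^+ N.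

Let M_ge1 : 1 <= M.
Proof. exact (density_bound_ge1 (X_density (Ordinal n_gt0)) (ltW b_gt0) f_bounds). Qed.

Let b_le_M : b <= M.
Proof.
have [y [y01 _]] := proper_nonempty (@proper_unit_rect R d).
by have /andP[] := f_bounds y01; exact: le_trans.
Qed.

Let M_gt0 : 0 < M. Proof. exact: lt_le_trans M_ge1. Qed.

Let b_div_M : 0 <= b / M <= 1.
Proof. by rewrite divr_ge0 ?(ltW b_gt0) ?(ltW M_gt0)//= ler_pdivrMr// mul1r. Qed.

Let tauE : tau = (b / M) ^+ N * rho ^+ N.
Proof. by rewrite /tau mulrAC exprMn. Qed.

Let rhoN_ge0 : 0 <= rho ^+ N.
Proof. by rewrite exprn_ge0//; have := rho_bounds; lra. Qed.

Lemma threshold_le_rhoN : tau <= rho ^+ N.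
Proof. by rewrite tauE ler_piMl// exprn_ile1//; have := b_div_M; lra. Qed.

(** [(b/M)^N <= b/M <= b], from [N >= 1], [b <= M] and [1 <= M]. Hence every cell of depth at most
    [N] is large enough for [count_in_bounds]. *)
Lemma threshold_le_b_rhoN : tau <= b * rho ^+ N.
Proof.
rewrite tauE ler_wpM2r//; apply: (@le_trans _ _ (b / M)).
  by have /andP[? ?] := b_div_M; rewrite -(prednK N_gt0) exprS ler_piMr// exprn_ile1.
by rewrite ler_pdivrMr// ler_peMr// ltW.
Qed.

Lemma cell_volume_ge y w i : unit_cube R d y -> (i <= N)%N ->
  rho ^+ i <= volume (cell (t w) y i).
Proof.
move=> y01; elim: i => [_|i IH iN].
  by rewrite /volume big1// => j _; rewrite /side /= subr0.
rewrite (volume_cellS (t_pos t_random w))// exprS.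
have /andP[r0 r1] := rho_bounds.
apply: ler_pM; [exact: ltW|exact/exprn_ge0/ltW|exact: (U_bounds y01 (Ordinal iN))|exact/IH/ltnW].
Qed.

(** [b rho / (8 M)] times the parent's upper bound [5/2 n M v] is [5/16 n b rho v], while the child,
    of volume at least [rho v], holds at least [3/8 n b rho v] points. *)
Lemma regular_of_no_deviation w : d%:R / n%:R <= tau / 4 ->
  ~ some_deviation b M tau X w ->
  tree_regular (empirical X w) (b * rho / (8 * M)) N (t w).
Proof.
move=> dn good y y01 i iN.
have /andP[r0 r1] := rho_bounds.
have n0 : 0 < n%:R :> R by rewrite ltr0n.
have pV k : (k <= N)%N -> proper_rect (cell (t w) y k) by exact: (proper_cell (t_pos t_random w)).
have vol k : (k <= N)%N -> rho ^+ N <= volume (cell (t w) y k).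
  move=> kN; apply: le_trans (cell_volume_ge w y01 kN).
  by rewrite ler_wiXn2l// ltW.
have bounds k : (k <= N)%N ->
  3 / 8 * (n%:R * b * volume (cell (t w) y k)) <=
    count_in X (in_rect (cell (t w) y k)) w <=
  5 / 2 * (n%:R * M * volume (cell (t w) y k)).
  move=> kN; apply: (count_in_bounds d_gt0 n_gt0 b_gt0 _ f_bounds X_density good (pV k kN)).
  - by rewrite exprn_gt0// divr_gt0// mulr_gt0.
  - by apply: le_trans threshold_le_b_rhoN _; rewrite ler_wpM2l ?(ltW b_gt0)// vol.
  - by have := threshold_le_rhoN; have := vol k kN; lra.
have /andP[_ hV] := bounds i (ltnW iN).
have /andP[hW _] := bounds i.+1 iN.
rewrite (volume_cellS (t_pos t_random w))// in hW.
have hu : rho <= position (t w) y i by exact: (U_bounds y01 (Ordinal iN)).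
set v := volume _ in hV hW.
have v0 : 0 <= v by apply: le_trans rhoN_ge0 (vol i (ltnW iN)).
rewrite /empirical mulrCA ler_wpM2l ?invr_ge0//.
apply: le_trans hW.
have c0 : 0 <= b * rho / (8 * M).
  by rewrite divr_ge0// mulr_ge0// ltW.
apply: le_trans (ler_wpM2l c0 hV) _.
have -> : b * rho / (8 * M) * (5 / 2 * (n%:R * M * v)) = 5 / 16 * (n%:R * b * (rho * v)).
  by field; rewrite gt_eqF.
have h : rho * v <= position (t w) y i * v by rewrite ler_wpM2r.
have nb : 0 <= n%:R * b by rewrite mulr_ge0// ltW.
have := ler_wpM2l nb h.
have : 0 <= n%:R * b * (rho * v) by rewrite !mulr_ge0// ltW.
lra.
Qed.
End regularity.

(** * Consequences of the sample-size condition *)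

Section sample_size.
Context {R : realType}.
Variables (d n : nat) (nu tau : R).
Hypotheses (d_gt0 : (0 < d)%N) (n_gt0 : (0 < n)%N) (nu_ge1 : 1 <= nu).
Hypothesis size_cond :
  16 * ln (192 * d%:R * nu ^+ 4 * (2 * n%:R + 1) ^+ (2 * d)) <= n%:R * tau.

Let d0 : 0 < d%:R :> R. Proof. by rewrite ltr0n. Qed.
Let n1 : 1 <= n%:R :> R. Proof. by rewrite ler1n. Qed.
Let nu4 : 1 <= nu ^+ 4. Proof. by rewrite exprn_ege1. Qed.
Let nu0 : 0 < nu. Proof. exact: lt_le_trans nu_ge1. Qed.

Let g : R := (2 * n%:R + 1) ^+ (2 * d).
Let g_gt0 : 0 < g. Proof. by rewrite exprn_gt0//; have := n1; lra. Qed.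
Let c : R := 192 * d%:R * nu ^+ 4.
Let c_gt0 : 0 < c. Proof. by rewrite !mulr_gt0// exprn_gt0. Qed.

(** The exponential is at most the inverse of [192 d nu^4 (2n+1)^(2d)]; the number of boxes cancels,
    and the factor 2 for the two tails turns 192 into 96. *)
Lemma deviation_bound_le :
  2 * g * expR (- (n%:R * tau / 16)) <= nu ^- 4 / (96 * d%:R).
Proof.
have h : expR (- (n%:R * tau / 16)) <= (c * g)^-1.
  have cg : c * g \is Num.pos by rewrite posrE mulr_gt0.
  rewrite -[c * g]lnK// -expRN ler_expR lerN2; move: size_cond; rewrite -/c -/g; lra.
have g2 : 0 <= 2 * g by rewrite mulr_ge0// ltW.
apply: le_trans (ler_wpM2l g2 h) _.
rewrite le_eqVlt; apply/orP; left; apply/eqP; rewrite /c.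
by field; rewrite !gt_eqF.
Qed.

(** The number of boxes inside the logarithm pays for this: [expR (d/4) <= 2^d <= (2n+1)^(2d)], so
    the condition forces [n tau >= 4 d]. *)
Lemma dimension_le_sample : d%:R / n%:R <= tau / 4.
Proof.
have n0 : 0 < n%:R :> R by exact: lt_le_trans n1.
suff : d%:R / 4 <= ln (c * g).
  by move=> h; rewrite ler_pdivrMr//; move: size_cond; rewrite -/c -/g; lra.
have cg : c * g \is Num.pos by rewrite posrE mulr_gt0.
rewrite -ler_expR lnK// expRM_natl.
have e4 : expR 4^-1 <= 2 :> R.
  have -> : expR (4^-1 : R) = (expR (- 4^-1))^-1 by rewrite expRN invrK.
  have h := expR_ge1Dx (- 4^-1 : R).
  rewrite -[2]invrK lef_pV2 ?posrE ?expR_gt0//; lra.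
have c1 : 1 <= c.
  rewrite /c -[1]mulr1; apply: ler_pM => //.
  by have : 1 <= d%:R :> R by [rewrite ler1n]; lra.
apply: le_trans (_ : 2 ^+ d <= _).
  by rewrite lerXn2r ?nnegrE ?expR_ge0.
apply: le_trans (_ : g <= _); last by rewrite ler_peMl// ltW.
apply: le_trans (_ : (2 * n%:R + 1) ^+ d <= _).
  by rewrite lerXn2r ?nnegrE//; have := n1; lra.
by rewrite ler_weXn2l ?leq_pmull//; have := n1; lra.
Qed.
End sample_size.

Unset Implicit Arguments.
Set Strict Implicit.

Theorem theorem17 (R : realType) (disp : measure_display)
    (Omega : measurableType disp) (P : probability Omega R)
    (d n N : nat) (b M rho : R) (f : vec R d -> R)
    (X : 'I_n -> Omega -> vec R d) (t : Omega -> tree R d)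
    (d_ge2 : (2 <= d)%N) (n_ge1 : (1 <= n)%N) (N_ge1 : (1 <= N)%N)
    (b_gt0 : 0 < b) (M_gt0 : 0 < M)
    (f_bounds : forall y, unit_cube R d y -> b <= f y <= M)
    (X_measurable : forall i, measurable_fun setT (X i))
    (X_density : forall i, has_density_on_cube P f (X i))
    (X_independent :
       mutually_independent P (fun i => generated_by measurable (X i)))
    (t_random : is_random_tree N t)
    (DU_independent : forall y, unit_cube R d y ->
       independent2 P (generated_by setT (directions N t y))
                      (generated_by measurable (positions N t y)))
    (D_independent : forall y, unit_cube R d y ->
       mutually_independent P
         (fun i : 'I_N => generated_by setT (fun w => direction (t w) y i)))
    (D_uniform : forall y, unit_cube R d y -> forall (i : 'I_N) (j : 'I_d),
       P [set w | direction (t w) y i = j] = (d%:R^-1)%:E)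
    (rho_bounds : 0 < rho <= 1 / 2)
    (U_bounds : forall y, unit_cube R d y -> forall (i : 'I_N) (w : Omega),
       rho <= position (t w) y i <= 1 - rho) :
  let nu := ln rho / ln (1 - rho) in
  16 * ln (192 * d%:R * nu ^+ 4 * (2 * n%:R + 1) ^+ (2 * d)) <=
    n%:R * (b * rho / M) ^+ N ->
  forall x, unit_cube R d x ->
  ((nu ^- 4 / (24 * d%:R))%:E <=
   P [set w |
      (tree_regular (empirical X w) (b * rho / (8 * M)) N (t w) /\
       (1 - rho) `^ (- Num.sqrt (N%:R / d%:R)) <=
         h_plus (cell (t w) x N) / h_minus (cell (t w) x N))%R])%E.
Proof.
move=> nu size_cond x x01.
have d_gt0 : (0 < d)%N by exact: ltnW.
have dR0 : 0 < d%:R :> R by rewrite ltr0n.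
have rho01 : 0 < rho <= 1 by lra.
have nu_ge1 : 1 <= nu := log_ratio_ge1 rho_bounds.
pose a0 : 'I_d := Ordinal d_gt0; pose a1 : 'I_d := Ordinal d_ge2.
have a01 : a0 != a1 by [].
set tau := (b * rho / M) ^+ N in size_cond.
set dev := some_deviation b M tau X.
set E := [set w | _].
pose S := shape_event N rho t x a0 a1.
have tau0 : 0 < tau by rewrite exprn_gt0// divr_gt0// mulr_gt0//; lra.
have mS : measurable S by exact: measurable_shape_event.
have mdev : measurable dev by exact: measurable_some_deviation.
(* Needed to pass from the probability of the subset [S] minus [dev] to that of [E]. *)
have mE : measurable E.
  apply: measurableI; first exact: measurable_tree_regular.
  exact: measurable_cell_ratio.
have sub : S `&` ~` dev `<=` E.
  move=> w [Sw good]; split.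
    apply: (regular_of_no_deviation d_gt0 n_ge1 N_ge1 b_gt0 f_bounds X_density t_random) good => //.
      by move=> y y01 i w'; have /andP[] := U_bounds y y01 i w'.
    exact: dimension_le_sample size_cond.
  exact: (shape_event_ratio a01 rho_bounds t_random (U_bounds x x01) Sw).
have finE : P E \is a fin_num by exact: fin_num_measure.
rewrite -(fineK finE) lee_fin.
apply: le_trans (prob_le_mono P _ mE sub); last by apply: measurableI => //; exact: measurableC.
apply: le_trans (prob_setI_ge P mS (measurableC mdev)); rewrite setCK.
have hS := shape_event_prob a01 N_ge1 rho_bounds t_random x01 (DU_independent x x01)
  (D_independent x x01) (D_uniform x x01) (U_bounds x x01).
have hdev := some_deviation_prob n_ge1 b_gt0 tau0 f_bounds X_measurable
  X_density X_independent.
have := le_trans hdev (deviation_bound_le d_gt0 nu_ge1 size_cond).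
have quot (a k : R) : a / (k * d%:R) = a / d%:R / k.
  by rewrite invfM mulrCA mulrC.
have : 0 <= nu ^- 4 / d%:R.
  by rewrite divr_ge0 ?invr_ge0 ?exprn_ge0// (le_trans ler01 nu_ge1).
(* In units of [nu^-4 / d]: [1/8 - 1/96 = 11/96], which exceeds [1/24]. *)
move: hS; rewrite -/nu -/S -/dev !quot; lra.
Qed.
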